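(* Let $G$ be a localic étale groupoid and let $Q=\mathcal O(G)$. The categories $BG$, $Q\text{-}\mathbf{LH}$ and $Q\text{-}\mathbf{Sh}$ are isomorphic.
   Context: Locales: $\mathbf{Loc}$ is the category of locales and continuous maps, the opposite of the category of frames. For a locale $X$, $\mathcal O(X)$ is the corresponding frame; a map $f:X\to Y$ is given by its inverse image $f^*:\mathcal O(Y)\to\mathcal O(X)$; if $f$ is open, $f_!$ denotes its direct image, the left adjoint of $f^*$. Involutive quantales and modules: an involutive quantale is a sup-lattice (complete lattice) $Q$ with an associative multiplication preserving arbitrary joins in each variable and a join-preserving involution $a\mapsto a^*$ with $a^{**}=a$, $(ab)^*=b^*a^*$; it is unital if the multiplication has a unit $e$. $1$ denotes a top element. A (left) $Q$-module is a sup-lattice $M$ with an associative action $Q\times M\to M$ preserving joins in each variable, with $ex=x$ if $Q$ is unital. Homomorphisms preserve arbitrary joins and the action. Groupoids: a localic groupoid $G$ is an internal groupoid in $\mathbf{Loc}$, with objects $G_0$, arrows $G_1$, domain and range $d,r:G_1\to G_0$, units $u:G_0\to G_1$, inversion $i:G_1\to G_1$, multiplication $m:G_2\to G_1$, where $G_2$ is the pullback of $r$ (first projection) and $d$ (second projection). It is étale if $d$ is a local homeomorphism (then all structure maps are local homeomorphisms). For $G$ étale, $\mathcal O(G)$ is the unital involutive quantale with underlying frame $\mathcal O(G_1)$, multiplication $\mathcal O(G_1)\otimes\mathcal O(G_1)\to\mathcal O(G_2)\xrightarrow{m_!}\mathcal O(G_1)$ (first arrow the canonical quotient), involution $i_!$,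 and unit $e=u_!(1)$. $BG$: a (left) $G$-locale is a locale $X$ with a map $p:X\to G_0$ (the projection) and a map $\mathfrak a:G_1\times_{G_0}X\to X$ (pullback of $r$ and $p$) with $p\circ\mathfrak a=d\circ\pi_1$, $\mathfrak a\circ(1\times\mathfrak a)=\mathfrak a\circ(m\times 1)$ (modulo the canonical isomorphism $G_1\times_{G_0}(G_1\times_{G_0}X)\cong G_2\times_{G_0}X$), and $\mathfrak a\circ\langle u\circ p,1\rangle=\mathrm{id}_X$. An equivariant map $f:X\to Y$ is a map of locales over $G_0$ with $f\circ\mathfrak a=\mathfrak b\circ(1\times f)$, where $\mathfrak a,\mathfrak b$ are the actions on $X$, $Y$. A $G$-sheaf is a $G$-locale whose projection $p$ is a local homeomorphism. $BG$ (the classifying topos of $G$) is the category of $G$-sheaves and equivariant maps. $Q$-sheaves: let $Q=\mathcal O(G)$ and $B=\{b\in Q\mid b\le e\}$. A $Q$-locale is a locale $X$ with a (unital) left $Q$-module structure on $\mathcal O(X)$ such that $bx=b1\wedge x$ for all $b\in B$, $x\in\mathcal O(X)$. It is open if there is a (necessarily unique) homomorphism of $B$-modules $\varsigma:\mathcal O(X)\to B$ (the support) such that $\varsigma(x)x=x$ for all $x$. A local section of an open $Q$-locale $X$ is an element $s\in\mathcal O(X)$ such that $x=\varsigma(x)s$ for all $x\le s$; the set of local sections is $\Gamma_X$. A $Q$-sheaf (étale $Q$-locale) is an open $Q$-locale $X$ with $\bigvee\Gamma_X=1$. $Q\text{-}\mathbf{LH}$ is the category whose objects are the $Q$-sheaves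 and whose morphisms $f:X\to Y$ are the maps of locales such that $f^*$ is a homomorphism of $Q$-modules. $Q\text{-}\mathbf{Sh}$ is the category whose objects are the $Q$-sheaves and whose morphisms from $X$ to $Y$ are the sheaf homomorphisms, i.e. the homomorphisms of left $Q$-modules $h:\mathcal O(X)\to\mathcal O(Y)$ with $\varsigma(h(x))=\varsigma(x)$ for all $x\in\mathcal O(X)$ and $h(\Gamma_X)\subset\Gamma_Y$. *)

(* Defs.v *)
From mathcomp Require Import ssreflect ssrfun ssrbool boolp classical_sets.

Set Implicit Arguments.
Unset Strict Implicit.
Unset Printing Implicit Defensive.

Local Open Scope classical_set_scope.

#[local] Obligation Tactic := idtac.

Declare Scope locale_scope.
Delimit Scope locale_scope with L.
Local Open Scope locale_scope.

Record category := Category {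
  obj :> Type;
  hom : obj -> obj -> Type;
  idm : forall A, hom A A;
  compm : forall A B C, hom B C -> hom A B -> hom A C;
  compm_idl : forall A B (f : hom A B), compm (idm B) f = f;
  compm_idr : forall A B (f : hom A B), compm f (idm A) = f;
  compm_assoc : forall A B C D (h : hom C D) (g : hom B C) (f : hom A B),
    compm h (compm g f) = compm (compm h g) f
}.

Record functor (C D : category) := Functor {
  fobj :> C -> D;
  fmap : forall A B, hom A B -> hom (fobj A) (fobj B);
  fmap_id : forall A, fmap (idm A) = idm (fobj A);
  fmap_comp : forall A B E (g : hom B E) (f : hom A B),
    fmap (compm g f) = compm (fmap g) (fmap f)
}.

Definition functor_id (C : category) : functor C C :=
  {| fobj := id; fmap := fun A B f => f;
     fmap_id := fun A => erefl; fmap_comp := fun A B E g f => erefl |}.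

Program Definition functor_comp (C D E : category) (K : functor D E)
    (F : functor C D) : functor C E :=
  {| fobj := fun A => K (F A); fmap := fun A B f => fmap K (fmap F f) |}.
Next Obligation. by move=> C D E K F A /=; rewrite !fmap_id. Qed.
Next Obligation. by move=> C D E K F A B X g f /=; rewrite !fmap_comp. Qed.

(* Strict isomorphism of categories: the two composites are equal, not merely
   naturally isomorphic, to the identity functors. *)
Definition isomorphic_categories (C D : category) : Prop :=
  exists (F : functor C D) (K : functor D C),
    functor_comp K F = functor_id C /\ functor_comp F K = functor_id D.

Record supLattice := SupLattice {
  sl_sort :> Type;
  sle : sl_sort -> sl_sort -> Prop;
  sup : set sl_sort -> sl_sort;
  sle_refl : forall x, sle x x;
  sle_trans : forall x y z, sle x y -> sle y z -> sle x z;
  sle_anti : forall x y, sle x y -> sle y x -> x = y;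
  sup_ub : forall (S : set sl_sort) x, S x -> sle x (sup S);
  sup_lub : forall (S : set sl_sort) y,
    (forall x, S x -> sle x y) -> sle (sup S) y
}.

Notation "x ⊑ y" := (sle x y) (at level 70, no associativity) : locale_scope.
Notation "⨆ S" := (sup S) (at level 35, right associativity) : locale_scope.

Definition inf (L : supLattice) (S : set L) : L :=
  ⨆ [set z | forall x, S x -> z ⊑ x].
Definition top (L : supLattice) : L := ⨆ setT.
Definition meet (L : supLattice) (x y : L) : L := inf [set z | z = x \/ z = y].

Notation "x ⊓ y" := (meet x y) (at level 40, left associativity) : locale_scope.
Notation "⊤" := (top _) (at level 0) : locale_scope.

Definition preserves_sup (L M : supLattice) (f : L -> M) : Prop :=
  forall S : set L, f (⨆ S) = ⨆ (f @` S).

Section SupLatticeTheory.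
Variable L : supLattice.
Implicit Types (x y z : L) (S : set L).

Lemma inf_lb S x : S x -> inf S ⊑ x.
Proof. by move=> Sx; apply: sup_lub => z; apply. Qed.

Lemma inf_glb S y : (forall x, S x -> y ⊑ x) -> y ⊑ inf S.
Proof. by move=> h; apply: sup_ub. Qed.

Lemma top_max x : x ⊑ ⊤.
Proof. exact: sup_ub. Qed.

Lemma meetl x y : x ⊓ y ⊑ x.
Proof. by apply: inf_lb; left. Qed.

Lemma meetr x y : x ⊓ y ⊑ y.
Proof. by apply: inf_lb; right. Qed.

Lemma meet_glb x y z : z ⊑ x -> z ⊑ y -> z ⊑ x ⊓ y.
Proof. by move=> zx zy; apply: inf_glb => t [] ->. Qed.

Lemma meetC x y : x ⊓ y = y ⊓ x.
Proof.
by apply: sle_anti; apply: meet_glb; (exact: meetl || exact: meetr).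
Qed.

Lemma meet_mono x y x' y' : x ⊑ x' -> y ⊑ y' -> x ⊓ y ⊑ x' ⊓ y'.
Proof.
move=> xx yy; apply: meet_glb.
  by apply: sle_trans xx; exact: meetl.
by apply: sle_trans yy; exact: meetr.
Qed.

Lemma meetA x y z : x ⊓ (y ⊓ z) = x ⊓ y ⊓ z.
Proof.
apply: sle_anti.
  apply: meet_glb; first by apply: meet_mono; [exact: sle_refl | exact: meetl].
  by apply: (sle_trans (meetr _ _)); exact: meetr.
apply: meet_glb; first by apply: (sle_trans (meetl _ _)); exact: meetl.
by apply: meet_mono; [exact: meetr | exact: sle_refl].
Qed.

Lemma meetACA x y z t : (x ⊓ y) ⊓ (z ⊓ t) = (x ⊓ z) ⊓ (y ⊓ t).
Proof. by rewrite !meetA -(meetA x y) (meetC y z) !meetA. Qed.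

Lemma meet_idPl x y : x ⊑ y -> x ⊓ y = x.
Proof.
by move=> xy; apply: sle_anti; [exact: meetl | apply: meet_glb => //; exact: sle_refl].
Qed.

Lemma meet_id x : x ⊓ x = x.
Proof. by apply: meet_idPl; exact: sle_refl. Qed.

Lemma meetT x : x ⊓ ⊤ = x.
Proof. by apply: meet_idPl; exact: top_max. Qed.

Lemma meetTl x : ⊤ ⊓ x = x.
Proof. by rewrite meetC meetT. Qed.

Lemma sle_eq x y : x = y -> x ⊑ y.
Proof. by move=> ->; exact: sle_refl. Qed.

Lemma eq_sle x y : (forall z, x ⊑ z <-> y ⊑ z) -> x = y.
Proof. by move=> h; apply: sle_anti; apply/h; exact: sle_refl. Qed.

Lemma top_eq x : ⊤ ⊑ x -> x = ⊤.
Proof. by move=> h; apply: sle_anti => //; exact: top_max. Qed.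

End SupLatticeTheory.

Lemma preserves_sup_mono (L M : supLattice) (f : L -> M) :
  preserves_sup f -> forall x y, x ⊑ y -> f x ⊑ f y.
Proof.
move=> hf x y xy.
have -> : y = ⨆ [set z | z = x \/ z = y].
  apply: sle_anti; first by apply: sup_ub; right.
  by apply: sup_lub => z [] -> //; exact: sle_refl.
by rewrite hf; apply: sup_ub; exists x => //; left.
Qed.

(* A locale is given by its frame of opens. *)
Record locale := Locale {
  opens :> supLattice;
  meet_sup : forall (x : opens) (S : set opens),
    x ⊓ (⨆ S) = ⨆ ((fun y => x ⊓ y) @` S)
}.

(* A continuous map [X -> Y] is given by its inverse image, a frame
   homomorphism from the opens of [Y] to the opens of [X]. *)
Record cmap (X Y : locale) := CMap {
  inv_image : Y -> X;
  inv_image_sup : preserves_sup inv_image;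
  inv_image_meet : forall x y, inv_image (x ⊓ y) = inv_image x ⊓ inv_image y;
  inv_image_top : inv_image ⊤ = ⊤
}.

Notation "f ^*" := (inv_image f) : locale_scope.

Lemma cmap_eq (X Y : locale) (f g : cmap X Y) : (forall y, f^* y = g^* y) -> f = g.
Proof.
case: f g => [f f1 f2 f3] [g g1 g2 g3] /= /funext fg; subst g.
by congr CMap; exact: Prop_irrelevance.
Qed.

Lemma inv_image_mono (X Y : locale) (f : cmap X Y) x y : x ⊑ y -> f^* x ⊑ f^* y.
Proof. exact: (preserves_sup_mono (@inv_image_sup _ _ f)). Qed.

Program Definition cid_map (X : locale) : cmap X X :=
  {| inv_image := id |}.
Next Obligation. by move=> X S; rewrite image_id. Qed.
Next Obligation. by []. Qed.
Next Obligation. by []. Qed.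

Program Definition ccomp (X Y Z : locale) (g : cmap Y Z) (f : cmap X Y) : cmap X Z :=
  {| inv_image := fun z => f^* (g^* z) |}.
Next Obligation. by move=> X Y Z g f S /=; rewrite !inv_image_sup image_comp. Qed.
Next Obligation. by move=> X Y Z g f x y /=; rewrite !inv_image_meet. Qed.
Next Obligation. by move=> X Y Z g f /=; rewrite !inv_image_top. Qed.

Notation "g ∘ f" := (ccomp g f) (at level 40, left associativity) : locale_scope.

Lemma ccompA (W X Y Z : locale) (h : cmap Y Z) (g : cmap X Y) (f : cmap W X) :
  h ∘ (g ∘ f) = (h ∘ g) ∘ f.
Proof. exact: cmap_eq. Qed.

Lemma ccomp_idl (X Y : locale) (f : cmap X Y) : cid_map Y ∘ f = f.
Proof. exact: cmap_eq. Qed.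

Lemma ccomp_idr (X Y : locale) (f : cmap X Y) : f ∘ cid_map X = f.
Proof. exact: cmap_eq. Qed.

Definition is_iso (X Y : locale) (f : cmap X Y) : Prop :=
  exists g : cmap Y X, g ∘ f = cid_map X /\ f ∘ g = cid_map Y.

Definition left_adjoint (X Y : locale) (fs : X -> Y) (f : cmap X Y) : Prop :=
  forall x y, fs x ⊑ y <-> x ⊑ f^* y.

Definition is_open (X Y : locale) (f : cmap X Y) : Prop :=
  exists fs : X -> Y, left_adjoint fs f /\
    (forall x y, fs (x ⊓ f^* y) = fs x ⊓ y).

(* The left adjoint of [f^*] whenever one exists, in particular when
   [f] is open; see [direct_image_adj]. *)
Definition direct_image (X Y : locale) (f : cmap X Y) (x : X) : Y :=
  inf [set y | x ⊑ f^* y].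

Lemma direct_imageE (X Y : locale) (f : cmap X Y) (fs : X -> Y) :
  left_adjoint fs f -> direct_image f = fs.
Proof.
move=> adj; apply: funext => x; apply: sle_anti.
  by apply: inf_lb; apply/adj; exact: sle_refl.
by apply: inf_glb => y /adj.
Qed.

Lemma direct_image_adj (X Y : locale) (f : cmap X Y) :
  is_open f -> left_adjoint (direct_image f) f.
Proof. by case=> fs [adj _]; rewrite (direct_imageE adj). Qed.

Lemma direct_image_frob (X Y : locale) (f : cmap X Y) : is_open f ->
  forall x y, direct_image f (x ⊓ f^* y) = direct_image f x ⊓ y.
Proof. by case=> fs [adj fr]; rewrite (direct_imageE adj). Qed.

Section OpenSublocale.
Variables (X : locale) (u : X).

Program Definition open_sub_sl : supLattice :=
  {| sl_sort := {x : X | x ⊑ u};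
     sle := fun x y => sval x ⊑ sval y;
     sup := fun S => exist _ (⨆ (sval @` S)) _ |}.
Next Obligation. by move=> S; apply: sup_lub => _ [[x xu] _ <-]. Qed.
Next Obligation. by move=> x; exact: sle_refl. Qed.
Next Obligation. by move=> x y z; exact: sle_trans. Qed.
Next Obligation.
move=> [x xu] [y yu] /= xy yx; apply: eq_exist; exact: sle_anti.
Qed.
Next Obligation. by move=> S x Sx; apply: sup_ub; exists x. Qed.
Next Obligation. by move=> S y h; apply: sup_lub => _ [x Sx <-]; exact: h. Qed.

Lemma open_sub_meet (x y : open_sub_sl) : sval (x ⊓ y) = sval x ⊓ sval y.
Proof.
apply: sle_anti; first by apply: meet_glb; [exact: (meetl x y) | exact: (meetr x y)].
have h : sval x ⊓ sval y ⊑ u by apply: sle_trans (meetl _ _) (svalP x).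
have k : (exist (fun z => z ⊑ u) _ h : open_sub_sl) ⊑ x ⊓ y.
  by apply: meet_glb; [exact: meetl | exact: meetr].
exact: k.
Qed.

Lemma sval_inj_sub (x y : open_sub_sl) : sval x = sval y -> x = y.
Proof. by case: x y => [x hx] [y hy] /= e; exact: eq_exist. Qed.

Lemma open_sub_meet_sup (x : open_sub_sl) (S : set open_sub_sl) :
  x ⊓ (⨆ S) = ⨆ ((fun y => x ⊓ y) @` S).
Proof.
apply: sval_inj_sub; rewrite open_sub_meet [LHS]/= meet_sup [RHS]/= !image_comp.
by congr sup; congr image; apply: funext => y; exact/esym/open_sub_meet.
Qed.

Definition open_sub : locale := {| meet_sup := open_sub_meet_sup |}.

Program Definition open_incl : cmap open_sub X :=
  {| inv_image := fun x => exist _ (x ⊓ u) (meetr x u) |}.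
Next Obligation.
move=> S; apply: sval_inj_sub => /=; rewrite meetC meet_sup image_comp.
by congr sup; congr image; apply: funext => y /=; rewrite meetC.
Qed.
Next Obligation.
by move=> x y; apply: sval_inj_sub; rewrite open_sub_meet /= meetACA meet_id.
Qed.
Next Obligation.
apply: top_eq; rewrite /= meetTl; exact: (svalP (top open_sub_sl)).
Qed.

End OpenSublocale.

Definition is_local_homeo (X Y : locale) (f : cmap X Y) : Prop :=
  exists S : set X, ⨆ S = ⊤ /\
    forall s, S s -> exists (v : Y) (phi : cmap (open_sub s) (open_sub v)),
      is_iso phi /\ f ∘ open_incl s = open_incl v ∘ phi.

(* The frame of the pullback of [f : X -> Z] and [g : Y -> Z] is the coproduct
   of the frames of [X] and [Y] over that of [Z]: the opens are the sets [I] of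
   pairs (standing for the join of the opens [x ⊗ y] with [I x y]) that are
   down-closed, closed under joins in each variable, and balanced over [Z].
   Its universal property is [pb_universal] below. *)
Section Pullback.
Variables (X Y Z : locale) (f : cmap X Z) (g : cmap Y Z).

Record pb_ideal (I : X -> Y -> Prop) : Prop := PbIdeal {
  pbi_down : forall x y x' y', I x y -> x' ⊑ x -> y' ⊑ y -> I x' y';
  pbi_supl : forall (S : set X) y, (forall x, S x -> I x y) -> I (⨆ S) y;
  pbi_supr : forall x (S : set Y), (forall y, S y -> I x y) -> I x (⨆ S);
  pbi_bal : forall x y z, I (x ⊓ f^* z) y <-> I x (g^* z ⊓ y)
}.

Definition pb_gen (R : X -> Y -> Prop) (x : X) (y : Y) : Prop :=
  forall I, pb_ideal I -> (forall a b, R a b -> I a b) -> I x y.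

Lemma pb_gen_ideal R : pb_ideal (pb_gen R).
Proof.
split.
- by move=> x y x' y' h xx yy I iI RI; apply: (pbi_down iI) xx yy; exact: h.
- by move=> S y h I iI RI; apply: (pbi_supl iI) => x Sx; exact: h.
- by move=> x S h I iI RI; apply: (pbi_supr iI) => y Sy; exact: h.
- by move=> x y z; split=> h I iI RI; apply/(pbi_bal iI); exact: h.
Qed.

Lemma pb_gen_sub (R : X -> Y -> Prop) a b : R a b -> pb_gen R a b.
Proof. by move=> Rab I _; apply. Qed.

Program Definition pullback_sl : supLattice :=
  {| sl_sort := {I : X -> Y -> Prop | pb_ideal I};
     sle := fun I J => forall x y, sval I x y -> sval J x y;
     sup := fun S =>
       exist _ (pb_gen (fun x y => exists2 I, S I & sval I x y))
         (pb_gen_ideal _) |}.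
Next Obligation. by []. Qed.
Next Obligation. by move=> I J K IJ JK x y /IJ /JK. Qed.
Next Obligation.
move=> [I hI] [J hJ] /= IJ JI; apply: eq_exist.
by apply: funext => x; apply: funext => y; apply: propext; split; [exact: IJ|exact: JI].
Qed.
Next Obligation. by move=> S I SI x y Ixy; apply: pb_gen_sub; exists I. Qed.
Next Obligation.
move=> S J h x y; apply; first exact: (svalP J).
by move=> a b [I SI Iab]; exact: (h I).
Qed.

Definition opn (I : pullback_sl) : X -> Y -> Prop := sval I.

Lemma opnP (I : pullback_sl) : pb_ideal (opn I).
Proof. exact: svalP. Qed.

Lemma opn_capP (I J : pullback_sl) : pb_ideal (fun x y => opn I x y /\ opn J x y).
Proof.
have [iI iJ] := (opnP I, opnP J); split.
- by move=> x y x' y' [h k] xx yy; split; [apply: (pbi_down iI) xx yy|apply: (pbi_down iJ) xx yy].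
- by move=> S y h; split; [apply: (pbi_supl iI)|apply: (pbi_supl iJ)] => x /h [].
- by move=> x S h; split; [apply: (pbi_supr iI)|apply: (pbi_supr iJ)] => y /h [].
- move=> x y z; split=> -[h k]; split.
  + exact/(pbi_bal iI). + exact/(pbi_bal iJ). + exact/(pbi_bal iI). + exact/(pbi_bal iJ).
Qed.

Lemma opn_meet (I J : pullback_sl) x y : opn (I ⊓ J) x y <-> opn I x y /\ opn J x y.
Proof.
split=> [h|h]; first by split; [exact: (meetl I J)|exact: (meetr I J)].
have : (exist _ _ (opn_capP I J) : pullback_sl) ⊑ I ⊓ J.
  by apply: meet_glb => a b [].
exact.
Qed.

Lemma opn_residual (I : pullback_sl) c d : pb_ideal (fun a b => opn I (c ⊓ a) (d ⊓ b)).
Proof.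
have iI := opnP I; split.
- move=> x y x' y' h xx yy; apply: (pbi_down iI) h _ _.
    by apply: meet_mono => //; exact: sle_refl.
  by apply: meet_mono => //; exact: sle_refl.
- by move=> S y h; rewrite meet_sup; apply: (pbi_supl iI) => _ [x Sx <-]; exact: h.
- by move=> x S h; rewrite meet_sup; apply: (pbi_supr iI) => _ [y Sy <-]; exact: h.
- move=> x y z; rewrite meetA; split=> h.
    move/(pbi_bal iI) : h; rewrite meetA (meetC _ d) -meetA; exact.
  by apply/(pbi_bal iI); rewrite meetA (meetC _ d) -meetA.
Qed.

Lemma pb_gen_residual (R : X -> Y -> Prop) (J I : pullback_sl) :
  (forall a b c d, R a b -> opn J c d -> opn I (c ⊓ a) (d ⊓ b)) ->
  forall a b, pb_gen R a b -> opn J a b -> opn I a b.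
Proof.
move=> h a b Rab Jab; rewrite -(meet_id a) -(meet_id b).
by apply: (Rab _ (opn_residual I a b)) => c d Rcd; exact: h.
Qed.

Lemma pullback_meet_sup (I : pullback_sl) (S : set pullback_sl) :
  I ⊓ (⨆ S) = ⨆ ((fun J => I ⊓ J) @` S).
Proof.
apply: sle_anti; last first.
  apply: sup_lub => _ [J SJ <-]; apply: meet_mono; first exact: sle_refl.
  exact: sup_ub.
move=> a b /opn_meet [Iab Sab].
apply: (@pb_gen_residual (fun x y => exists2 J, S J & sval J x y) I
  (⨆ ((fun J => I ⊓ J) @` S)) _ a b Sab Iab) => x y c d [J SJ Jxy] Icd.
apply: pb_gen_sub; exists (I ⊓ J); first by exists J.
apply/opn_meet; split.
  by apply: (pbi_down (opnP I)) Icd _ _; exact: meetl.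
by apply: (pbi_down (opnP J)) Jxy _ _; exact: meetr.
Qed.

Definition pullback : locale := {| meet_sup := pullback_meet_sup |}.

Definition tensor (x : X) (y : Y) : pullback :=
  exist _ (pb_gen (fun a b => a = x /\ b = y)) (pb_gen_ideal _).

Lemma tensor_le x y (I : pullback) : tensor x y ⊑ I <-> opn I x y.
Proof.
split=> [h|h a b]; first by apply: h; apply: pb_gen_sub.
by apply; [exact: opnP|move=> ? ? [-> ->]].
Qed.

Lemma tensor_meet x y x' y' :
  tensor x y ⊓ tensor x' y' = tensor (x ⊓ x') (y ⊓ y').
Proof.
apply: sle_anti; last first.
  apply/tensor_le/opn_meet; split.
    by apply: (pbi_down (opnP (tensor x y))); [exact/tensor_le/sle_refl| |]; exact: meetl.
  by apply: (pbi_down (opnP (tensor x' y'))); [exact/tensor_le/sle_refl| |]; exact: meetr.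
move=> a b /opn_meet [h k].
apply: (@pb_gen_residual (fun a b => a = x /\ b = y) (tensor x' y')
  (tensor (x ⊓ x') (y ⊓ y')) _ a b h k) => _ _ c d [-> ->] {}h.
rewrite (meetC c) (meetC d).
apply: (h _ (opn_residual (tensor (x ⊓ x') (y ⊓ y')) x y)) => _ _ [-> ->].
exact/tensor_le/sle_refl.
Qed.

Lemma tensor_supl (S : set X) y : tensor (⨆ S) y = ⨆ ((fun x => tensor x y) @` S).
Proof.
apply: sle_anti.
  apply/tensor_le; apply: (pbi_supl (opnP _)) => x Sx; apply/tensor_le.
  by apply: sup_ub; exists x.
apply: sup_lub => _ [x Sx <-]; apply/tensor_le.
apply: (pbi_down (opnP (tensor (⨆ S) y))); first exact/tensor_le/sle_refl.
  exact: sup_ub.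
exact: sle_refl.
Qed.

Lemma tensor_supr x (S : set Y) : tensor x (⨆ S) = ⨆ ((fun y => tensor x y) @` S).
Proof.
apply: sle_anti.
  apply/tensor_le; apply: (pbi_supr (opnP _)) => y Sy; apply/tensor_le.
  by apply: sup_ub; exists y.
apply: sup_lub => _ [y Sy <-]; apply/tensor_le.
apply: (pbi_down (opnP (tensor x (⨆ S)))); first exact/tensor_le/sle_refl.
  exact: sle_refl.
exact: sup_ub.
Qed.

Lemma tensor_top : tensor ⊤ ⊤ = ⊤.
Proof.
apply: top_eq => a b _.
apply: (pbi_down (opnP (tensor ⊤ ⊤))); first exact/tensor_le/sle_refl.
  exact: top_max.
exact: top_max.
Qed.

Program Definition pb_fst : cmap pullback X := {| inv_image := fun x => tensor x ⊤ |}.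
Next Obligation. by move=> S; rewrite tensor_supl. Qed.
Next Obligation. by move=> x y; rewrite tensor_meet meet_id. Qed.
Next Obligation. exact: tensor_top. Qed.

Program Definition pb_snd : cmap pullback Y := {| inv_image := fun y => tensor ⊤ y |}.
Next Obligation. by move=> S; rewrite tensor_supr. Qed.
Next Obligation. by move=> x y; rewrite tensor_meet meet_id. Qed.
Next Obligation. exact: tensor_top. Qed.

Lemma tensorE x y : tensor x y = pb_fst^* x ⊓ pb_snd^* y.
Proof. by rewrite -[pb_fst^* x]/(tensor x ⊤) -[pb_snd^* y]/(tensor ⊤ y) tensor_meet meetT meetTl. Qed.

Lemma pb_le x y (I : pullback) : pb_fst^* x ⊓ pb_snd^* y ⊑ I <-> opn I x y.
Proof. by rewrite -tensorE; exact: tensor_le. Qed.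

Lemma pb_comm : f ∘ pb_fst = g ∘ pb_snd.
Proof.
apply: cmap_eq => z; apply: sle_anti; apply/tensor_le.
  rewrite -(meetTl (f^* z)); apply/(pbi_bal (opnP _)); rewrite meetT.
  exact/tensor_le/sle_refl.
rewrite -(meetT (g^* z)); apply/(pbi_bal (opnP _)); rewrite meetTl.
exact/tensor_le/sle_refl.
Qed.

Lemma pb_density (I : pullback) :
  I = ⨆ [set T | exists x y, opn I x y /\ T = pb_fst^* x ⊓ pb_snd^* y].
Proof.
apply: sle_anti.
  move=> x y Ixy.
  have /pb_le : pb_fst^* x ⊓ pb_snd^* y
    ⊑ ⨆ [set T | exists x y, opn I x y /\ T = pb_fst^* x ⊓ pb_snd^* y].
    by apply: sup_ub; exists x, y.
  exact.
by apply: sup_lub => _ [x [y [Ixy ->]]]; exact/pb_le.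
Qed.

Lemma pb_jointly_monic (W : locale) (h k : cmap W pullback) :
  pb_fst ∘ h = pb_fst ∘ k -> pb_snd ∘ h = pb_snd ∘ k -> h = k.
Proof.
move=> e1 e2; apply: cmap_eq => I; rewrite (pb_density I) !inv_image_sup.
congr sup; apply: eq_imagel => _ [x [y [_ ->]]]; rewrite !inv_image_meet.
by congr meet; [move: (congr1 (fun t => t^* x) e1)|move: (congr1 (fun t => t^* y) e2)].
Qed.

Section Pairing.
Variables (W : locale) (h : cmap W X) (k : cmap W Y) (hk : f ∘ h = g ∘ k).

Definition pb_pair_inv (I : pullback) : W :=
  ⨆ [set w | exists x y, opn I x y /\ w = h^* x ⊓ k^* y].

Lemma pb_pair_ideal (w : W) : pb_ideal (fun x y => h^* x ⊓ k^* y ⊑ w).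
Proof.
split.
- move=> x y x' y' le_w xx yy; apply: sle_trans le_w.
  by apply: meet_mono; exact: inv_image_mono.
- move=> S y hS; rewrite inv_image_sup meetC meet_sup; apply: sup_lub.
  by move=> _ [_ [x Sx <-] <-]; rewrite meetC; exact: hS.
- move=> x S hS; rewrite inv_image_sup meet_sup; apply: sup_lub.
  by move=> _ [_ [y Sy <-] <-]; exact: hS.
- move=> x y z; rewrite !inv_image_meet -meetA.
  by have /= -> := congr1 (fun t => t^* z) hk.
Qed.

Lemma pb_pair_adj (I : pullback) w :
  pb_pair_inv I ⊑ w <-> I ⊑ exist _ _ (pb_pair_ideal w).
Proof.
split=> [le_w x y Ixy|le_w]; last by apply: sup_lub => _ [x [y [Ixy ->]]]; exact: le_w.
by apply: sle_trans le_w; apply: sup_ub; exists x, y.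
Qed.

Program Definition pb_pair : cmap W pullback := {| inv_image := pb_pair_inv |}.
Next Obligation.
move=> S; apply: eq_sle => w; split=> [/pb_pair_adj le_w|le_w].
  apply: sup_lub => _ [I SI <-]; apply/pb_pair_adj; apply: sle_trans le_w.
  exact: sup_ub.
apply/pb_pair_adj; apply: sup_lub => I SI; apply/pb_pair_adj; apply: sle_trans le_w.
by apply: sup_ub; exists I.
Qed.
Next Obligation.
move=> I J; apply: sle_anti.
  apply: sup_lub => _ [x [y [/opn_meet [Ixy Jxy] ->]]].
  by apply: meet_glb; apply: sup_ub; exists x, y.
rewrite {1}/pb_pair_inv meetC meet_sup; apply: sup_lub => _ [_ [x [y [Ixy ->]]] <-].
rewrite meetC meet_sup; apply: sup_lub => _ [_ [x' [y' [Jxy ->]]] <-].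
rewrite meetACA -!inv_image_meet; apply: sup_ub; exists (x ⊓ x'), (y ⊓ y'); split=> //.
apply/opn_meet; split.
  by apply: (pbi_down (opnP I)) Ixy _ _; exact: meetl.
by apply: (pbi_down (opnP J)) Jxy _ _; exact: meetr.
Qed.
Next Obligation.
apply: top_eq; apply: sup_ub; exists ⊤, ⊤; split; last by rewrite !inv_image_top meet_id.
by apply/pb_le; exact: top_max.
Qed.

Lemma pb_fst_pair : pb_fst ∘ pb_pair = h.
Proof.
apply: cmap_eq => x; apply: sle_anti.
  apply/pb_pair_adj/tensor_le; exact: meetl.
apply: sup_ub; exists x, ⊤; rewrite inv_image_top meetT; split=> //.
exact/tensor_le/sle_refl.
Qed.

Lemma pb_snd_pair : pb_snd ∘ pb_pair = k.
Proof.
apply: cmap_eq => y; apply: sle_anti.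
  apply/pb_pair_adj/tensor_le; exact: meetr.
apply: sup_ub; exists ⊤, y; rewrite inv_image_top meetTl; split=> //.
exact/tensor_le/sle_refl.
Qed.

Lemma pb_universal : exists! l : cmap W pullback, pb_fst ∘ l = h /\ pb_snd ∘ l = k.
Proof.
exists pb_pair; split; first by split; [exact: pb_fst_pair|exact: pb_snd_pair].
move=> l [l1 l2]; apply: pb_jointly_monic.
  by rewrite l1 pb_fst_pair.
by rewrite l2 pb_snd_pair.
Qed.

End Pairing.
End Pullback.

Arguments pb_fst {X Y Z f g}.
Arguments pb_snd {X Y Z f g}.
Arguments pb_comm {X Y Z f g}.
Arguments pb_pair {X Y Z f g W} h k hk.

Section PairLemmas.
Variables (X Y Z : locale) (f : cmap X Z) (g : cmap Y Z).

Lemma pb_pair_eq (W : locale) (h h' : cmap W X) (k k' : cmap W Y) H H' :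
  h = h' -> k = k' -> pb_pair h k H = pb_pair (f := f) (g := g) h' k' H'.
Proof. by move=> e1 e2; subst h' k'; congr pb_pair; exact: Prop_irrelevance. Qed.

Lemma pb_pair_comp (V W : locale) (h : cmap W X) (k : cmap W Y) H (w : cmap V W) H' :
  pb_pair h k H ∘ w = pb_pair (f := f) (g := g) (h ∘ w) (k ∘ w) H'.
Proof.
by apply: pb_jointly_monic; rewrite ccompA ?pb_fst_pair ?pb_snd_pair.
Qed.

Lemma pb_pair_id H : pb_pair pb_fst pb_snd H = cid_map (pullback f g).
Proof.
by apply: pb_jointly_monic; rewrite ?pb_fst_pair ?pb_snd_pair ccomp_idr.
Qed.

End PairLemmas.

(* The compatibility conditions needed to form the composites in the axioms for
   an action [a : G1 ×_{G0} X -> X]; the multiplication of the groupoid is the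
   special case [X = G1], [p = d]. *)
Section ActionAxioms.
Variables (G0 G1 : locale) (d r : cmap G1 G0) (u : cmap G0 G1).
Variables (m : cmap (pullback r d) G1).
Hypotheses (ru : r ∘ u = cid_map G0) (rm : r ∘ m = r ∘ pb_snd).
Variables (X : locale) (p : cmap X G0) (a : cmap (pullback r p) X).
Hypothesis pa : p ∘ a = d ∘ pb_fst.

(* [G2 ×_{G0} X] *)
Let G2X := pullback (r ∘ (pb_snd : cmap (pullback r d) G1)) p.

Lemma action_compat_mul : r ∘ (m ∘ pb_fst) = p ∘ (pb_snd : cmap G2X X).
Proof. by rewrite ccompA rm pb_comm. Qed.

Lemma action_compat_inner :
  r ∘ (pb_snd ∘ pb_fst) = p ∘ (pb_snd : cmap G2X X).
Proof. by rewrite ccompA pb_comm. Qed.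

Definition action_inner : cmap G2X X :=
  a ∘ pb_pair (pb_snd ∘ pb_fst) pb_snd action_compat_inner.

Lemma action_compat_outer : r ∘ (pb_fst ∘ pb_fst) = p ∘ action_inner.
Proof.
rewrite /action_inner (ccompA p) pa -ccompA pb_fst_pair !ccompA.
by congr ccomp; exact: pb_comm.
Qed.

(* [a ∘ (m × 1) = a ∘ (1 × a)], on [G2 ×_{G0} X]; the right-hand side includes
   the canonical isomorphism [G2 ×_{G0} X ≅ G1 ×_{G0} (G1 ×_{G0} X)]. *)
Definition action_assoc : Prop :=
  a ∘ pb_pair (m ∘ pb_fst) pb_snd action_compat_mul
  = a ∘ pb_pair (pb_fst ∘ pb_fst) action_inner action_compat_outer.

Lemma action_compat_unit : r ∘ (u ∘ p) = p ∘ cid_map X.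
Proof. by rewrite ccompA ru ccomp_idl ccomp_idr. Qed.

Definition action_unit : Prop :=
  a ∘ pb_pair (u ∘ p) (cid_map X) action_compat_unit = cid_map X.

End ActionAxioms.

Arguments action_assoc {G0 G1 d r} m rm {X p} a pa.
Arguments action_unit {G0 G1 r} u ru {X} p a.

Section GroupoidAxioms.
Variables (G0 G1 : locale) (d r : cmap G1 G0) (u : cmap G0 G1) (i : cmap G1 G1).
Variables (m : cmap (pullback r d) G1).

Lemma gpd_compat_unitr (du : d ∘ u = cid_map G0) : r ∘ cid_map G1 = d ∘ (u ∘ r).
Proof. by rewrite ccompA du ccomp_idl ccomp_idr. Qed.

Lemma gpd_compat_invr (di : d ∘ i = r) : r ∘ cid_map G1 = d ∘ i.
Proof. by rewrite di ccomp_idr. Qed.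

Lemma gpd_compat_invl (ri : r ∘ i = d) : r ∘ i = d ∘ cid_map G1.
Proof. by rewrite ri ccomp_idr. Qed.

End GroupoidAxioms.

Record groupoid := Groupoid {
  G0 : locale;
  G1 : locale;
  gd : cmap G1 G0;
  gr : cmap G1 G0;
  gu : cmap G0 G1;
  gi : cmap G1 G1;
  gm : cmap (pullback gr gd) G1;
  gdu : gd ∘ gu = cid_map G0;
  gru : gr ∘ gu = cid_map G0;
  gdm : gd ∘ gm = gd ∘ pb_fst;
  grm : gr ∘ gm = gr ∘ pb_snd;
  gmA : action_assoc gm grm gm gdm;
  gm1l : action_unit gu gru gd gm;
  gm1r : gm ∘ pb_pair (cid_map G1) (gu ∘ gr) (gpd_compat_unitr gr gdu) = cid_map G1;
  gdi : gd ∘ gi = gr;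
  gri : gr ∘ gi = gd;
  gmVr : gm ∘ pb_pair (cid_map G1) gi (gpd_compat_invr gdi) = gu ∘ gd;
  gmVl : gm ∘ pb_pair gi (cid_map G1) (gpd_compat_invl gri) = gu ∘ gr
}.

Definition etale (G : groupoid) : Prop := is_local_homeo (gd G).

Record glocale (G : groupoid) := GLocale {
  gl_locale :> locale;
  gl_proj : cmap gl_locale (G0 G);
  gl_act : cmap (pullback (gr G) gl_proj) gl_locale;
  gl_proj_act : gl_proj ∘ gl_act = gd G ∘ pb_fst;
  gl_actA : action_assoc (gm G) (grm G) gl_act gl_proj_act;
  gl_act1 : action_unit (gu G) (gru G) gl_proj gl_act
}.

Lemma gl_times_compat (G : groupoid) (X Y : glocale G) (f : cmap X Y)
    (pf : gl_proj Y ∘ f = gl_proj X) :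
  gr G ∘ (pb_fst : cmap (pullback (gr G) (gl_proj X)) (G1 G))
  = gl_proj Y ∘ (f ∘ pb_snd).
Proof. by rewrite ccompA pf pb_comm. Qed.

(* [1 × f : G1 ×_{G0} X -> G1 ×_{G0} Y] *)
Definition gl_times (G : groupoid) (X Y : glocale G) (f : cmap X Y)
    (pf : gl_proj Y ∘ f = gl_proj X) :
    cmap (pullback (gr G) (gl_proj X)) (pullback (gr G) (gl_proj Y)) :=
  pb_pair pb_fst (f ∘ pb_snd) (gl_times_compat pf).

Record equivariant (G : groupoid) (X Y : glocale G) := Equivariant {
  eqv_map :> cmap X Y;
  eqv_proj : gl_proj Y ∘ eqv_map = gl_proj X;
  eqv_act : eqv_map ∘ gl_act X = gl_act Y ∘ gl_times eqv_proj
}.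

Lemma equivariant_eq (G : groupoid) (X Y : glocale G) (f g : equivariant X Y) :
  (f : cmap X Y) = g -> f = g.
Proof.
case: f g => [f pf af] [g pg ag] /= e; subst g.
have e : pf = pg by exact: Prop_irrelevance.
by subst pg; congr Equivariant; exact: Prop_irrelevance.
Qed.

Program Definition equivariant_id (G : groupoid) (X : glocale G) : equivariant X X :=
  {| eqv_map := cid_map X; eqv_proj := ccomp_idr _ |}.
Next Obligation.
move=> G X; rewrite ccomp_idl -[LHS]ccomp_idr; congr ccomp.
by rewrite -(pb_pair_id pb_comm); apply: pb_pair_eq; rewrite ?ccomp_idl.
Qed.

Program Definition equivariant_comp (G : groupoid) (X Y Z : glocale G)
    (g : equivariant Y Z) (f : equivariant X Y) : equivariant X Z :=
  {| eqv_map := g ∘ f |}.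
Next Obligation. by move=> G X Y Z g f; rewrite ccompA !eqv_proj. Qed.
Next Obligation.
move=> G X Y Z g f; rewrite -ccompA eqv_act ccompA eqv_act -ccompA; congr ccomp.
by apply: pb_jointly_monic; rewrite ccompA !(pb_fst_pair, pb_snd_pair) // -ccompA
  !(pb_fst_pair, pb_snd_pair) // ccompA.
Qed.

Record gsheaf (G : groupoid) := GSheaf {
  gs_glocale :> glocale G;
  gs_local_homeo : is_local_homeo (gl_proj gs_glocale)
}.

Program Definition BG (G : groupoid) : category :=
  {| obj := gsheaf G;
     hom := fun X Y => equivariant X Y;
     idm := fun X => equivariant_id X;
     compm := fun X Y Z g f => equivariant_comp g f |}.
Next Obligation. by move=> G X Y f; apply: equivariant_eq; exact: ccomp_idl. Qed.
Next Obligation. by move=> G X Y f; apply: equivariant_eq; exact: ccomp_idr. Qed.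
Next Obligation. by move=> G A B C D h g f; apply: equivariant_eq; exact: ccompA. Qed.

Record uiQuantale := UIQuantale {
  uq_sl :> supLattice;
  qmul : uq_sl -> uq_sl -> uq_sl;
  qinv : uq_sl -> uq_sl;
  qone : uq_sl;
  qmulA : forall a b c, qmul a (qmul b c) = qmul (qmul a b) c;
  qmul1l : forall a, qmul qone a = a;
  qmul1r : forall a, qmul a qone = a;
  qmul_supl : forall b, preserves_sup (fun a => qmul a b);
  qmul_supr : forall a, preserves_sup (qmul a);
  qinvK : forall a, qinv (qinv a) = a;
  qinvM : forall a b, qinv (qmul a b) = qmul (qinv b) (qinv a);
  qinv_sup : preserves_sup qinv
}.

Record qmodule (Q : uiQuantale) (M : supLattice) := QModule {
  qact :> Q -> M -> M;
  qactA : forall a b x, qact (qmul a b) x = qact a (qact b x);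
  qact1 : forall x, qact (qone Q) x = x;
  qact_supl : forall x, preserves_sup (fun a => qact a x);
  qact_supr : forall a, preserves_sup (qact a)
}.

Record qlocale (Q : uiQuantale) := QLocale {
  ql_locale :> locale;
  ql_mod : qmodule Q ql_locale;
  ql_base : forall (b : Q) (x : ql_locale), b ⊑ qone Q ->
    ql_mod b x = ql_mod b ⊤ ⊓ x
}.

Notation "a · x" := (ql_mod _ a x) (at level 40, left associativity) : locale_scope.

(* [s] takes its values in [B = {b | b ⊑ e}], where joins and the action of [B]
   by multiplication are those of [Q]. *)
Record is_support (Q : uiQuantale) (X : qlocale Q) (s : X -> Q) : Prop := IsSupport {
  support_base : forall x, s x ⊑ qone Q;
  support_sup : preserves_sup s;
  support_act : forall (b : Q) x, b ⊑ qone Q -> s (b · x) = qmul b (s x);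
  support_self : forall x, s x · x = x
}.

Definition ql_open (Q : uiQuantale) (X : qlocale Q) : Prop :=
  exists s : X -> Q, is_support s.

Definition support (Q : uiQuantale) (X : qlocale Q) (oX : ql_open X) : X -> Q :=
  sval (cid oX).

Lemma supportP (Q : uiQuantale) (X : qlocale Q) (oX : ql_open X) :
  is_support (support oX).
Proof. exact: (svalP (cid oX)). Qed.

Lemma qmul_mono (Q : uiQuantale) (a a' b b' : Q) :
  a ⊑ a' -> b ⊑ b' -> qmul a b ⊑ qmul a' b'.
Proof.
move=> aa bb; apply: (@sle_trans _ _ (qmul a' b)).
  exact: (preserves_sup_mono (@qmul_supl Q b)).
exact: (preserves_sup_mono (@qmul_supr Q a')).
Qed.

Lemma support_unique (Q : uiQuantale) (X : qlocale Q) (s t : X -> Q) :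
  is_support s -> is_support t -> s = t.
Proof.
have aux (s' t' : X -> Q) : is_support s' -> is_support t' -> forall x, s' x ⊑ t' x.
  move=> hs ht x; rewrite -{1}(support_self ht x) (support_act hs); last exact: support_base.
  by rewrite -[X in _ ⊑ X]qmul1r; apply: qmul_mono; [exact: sle_refl|exact: support_base].
by move=> hs ht; apply: funext => x; apply: sle_anti; exact: aux.
Qed.

Definition local_section (Q : uiQuantale) (X : qlocale Q) (oX : ql_open X) : set X :=
  [set s | forall x, x ⊑ s -> x = support oX x · s].

Record qsheaf (Q : uiQuantale) := QSheaf {
  qs_qlocale :> qlocale Q;
  qs_open : ql_open qs_qlocale;
  qs_cover : ⨆ (local_section qs_open) = ⊤
}.

Record qlh_hom (Q : uiQuantale) (X Y : qsheaf Q) := QLHHom {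
  qlh_map :> cmap X Y;
  qlh_act : forall (a : Q) (y : Y), qlh_map^* (a · y) = a · qlh_map^* y
}.

Lemma qlh_hom_eq (Q : uiQuantale) (X Y : qsheaf Q) (f g : qlh_hom X Y) :
  (f : cmap X Y) = g -> f = g.
Proof.
by case: f g => [f hf] [g hg] /= e; subst g; congr QLHHom; exact: Prop_irrelevance.
Qed.

Program Definition QLH (Q : uiQuantale) : category :=
  {| obj := qsheaf Q;
     hom := fun X Y => qlh_hom X Y;
     idm := fun X => {| qlh_map := cid_map X |};
     compm := fun X Y Z g f => {| qlh_map := g ∘ f |} |}.
Next Obligation. by []. Qed.
Next Obligation. by move=> Q X Y Z g f a z /=; rewrite !qlh_act. Qed.
Next Obligation. by move=> Q X Y f; apply: qlh_hom_eq; exact: ccomp_idl. Qed.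
Next Obligation. by move=> Q X Y f; apply: qlh_hom_eq; exact: ccomp_idr. Qed.
Next Obligation. by move=> Q A B C D h g f; apply: qlh_hom_eq; exact: ccompA. Qed.

Record qsh_hom (Q : uiQuantale) (X Y : qsheaf Q) := QShHom {
  qsh_fun :> X -> Y;
  qsh_sup : preserves_sup qsh_fun;
  qsh_act : forall (a : Q) (x : X), qsh_fun (a · x) = a · qsh_fun x;
  qsh_support : forall x, support (qs_open Y) (qsh_fun x) = support (qs_open X) x;
  qsh_section : forall s, local_section (qs_open X) s ->
    local_section (qs_open Y) (qsh_fun s)
}.

Lemma qsh_hom_eq (Q : uiQuantale) (X Y : qsheaf Q) (h k : qsh_hom X Y) :
  (h : X -> Y) = k -> h = k.
Proof.
case: h k => [h h1 h2 h3 h4] [k k1 k2 k3 k4] /= e; subst k.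
by congr QShHom; exact: Prop_irrelevance.
Qed.

Program Definition QSh (Q : uiQuantale) : category :=
  {| obj := qsheaf Q;
     hom := fun X Y => qsh_hom X Y;
     idm := fun X => {| qsh_fun := id |};
     compm := fun X Y Z k h => {| qsh_fun := fun x => k (h x) |} |}.
Next Obligation. by move=> Q X S; rewrite image_id. Qed.
Next Obligation. by []. Qed.
Next Obligation. by []. Qed.
Next Obligation. by []. Qed.
Next Obligation. by move=> Q X Y Z k h S /=; rewrite !qsh_sup image_comp. Qed.
Next Obligation. by move=> Q X Y Z k h a x /=; rewrite !qsh_act. Qed.
Next Obligation. by move=> Q X Y Z k h x /=; rewrite !qsh_support. Qed.
Next Obligation. by move=> Q X Y Z k h s hs; do 2 apply: qsh_section. Qed.
Next Obligation. by move=> Q X Y f; exact: qsh_hom_eq. Qed.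
Next Obligation. by move=> Q X Y f; exact: qsh_hom_eq. Qed.
Next Obligation. by move=> Q A B C D h g f; exact: qsh_hom_eq. Qed.

Section OpenTheory.

Lemma left_adjoint_sup (X Y : locale) (f : cmap X Y) (fs : X -> Y) :
  left_adjoint fs f -> preserves_sup fs.
Proof.
move=> adj S; apply: eq_sle => y; split=> [/adj h|h].
  apply: sup_lub => _ [x Sx <-]; apply/adj; apply: sle_trans h.
  exact: sup_ub.
apply/adj; apply: sup_lub => x Sx; apply/adj; apply: sle_trans h.
by apply: sup_ub; exists x.
Qed.

Lemma is_openP (X Y : locale) (f : cmap X Y) (fs : X -> Y) :
  left_adjoint fs f ->
  (forall x y, fs x ⊓ y ⊑ fs (x ⊓ f^* y)) -> is_open f.
Proof.
move=> adj fr; exists fs; split=> // x y; apply: sle_anti => //.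
apply/adj; rewrite inv_image_meet; apply: meet_mono; last exact: sle_refl.
by apply/adj; exact: sle_refl.
Qed.

Lemma is_open_comp (X Y Z : locale) (g : cmap Y Z) (f : cmap X Y) :
  is_open g -> is_open f -> is_open (g ∘ f).
Proof.
move=> [gs [gadj gfr]] [fs [fadj ffr]]; exists (fun x => gs (fs x)); split.
  by move=> x z; rewrite gadj fadj.
by move=> x z /=; rewrite ffr gfr.
Qed.

Lemma iso_le (X Y : locale) (f : cmap X Y) (g : cmap Y X) :
  g ∘ f = cid_map X -> f ∘ g = cid_map Y ->
  forall x y, g^* x ⊑ y <-> x ⊑ f^* y.
Proof.
move=> gf fg x y.
have gfE z : f^* (g^* z) = z := congr1 (fun t => t^* z) gf.
have fgE z : g^* (f^* z) = z := congr1 (fun t => t^* z) fg.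
by split=> [/(inv_image_mono f)|/(inv_image_mono g)]; rewrite ?gfE ?fgE.
Qed.

Lemma is_open_iso (X Y : locale) (f : cmap X Y) : is_iso f -> is_open f.
Proof.
move=> [g [gf fg]]; apply: (@is_openP _ _ f g^*); first exact: iso_le.
move=> x y; rewrite inv_image_meet; apply: meet_mono; first exact: sle_refl.
by apply: sle_eq; exact: esym (congr1 (fun t => t^* y) fg).
Qed.

Lemma is_open_pb_snd (X Y Z : locale) (f : cmap X Z) (g : cmap Y Z) :
  is_open f -> is_open (pb_snd : cmap (pullback f g) Y).
Proof.
move=> [fs [adj fr]].
pose ps (J : pullback f g) : Y :=
  ⨆ [set t | exists x y, opn J x y /\ t = g^* (fs x) ⊓ y].
have psadj : left_adjoint ps pb_snd.
  move=> J y'; split=> [h x y Jxy|h].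
    have {}h : g^* (fs x) ⊓ y ⊑ y'.
      by apply: sle_trans h; apply: sup_ub; exists x, y.
    have <- : x ⊓ f^* (fs x) = x by apply: meet_idPl; apply/adj; exact: sle_refl.
    rewrite -/(opn (pb_snd^* y' : pullback f g) _ _).
    apply/(pbi_bal (opnP _)); apply: (pbi_down (opnP _) _ (top_max x) h).
    by apply/tensor_le; exact: sle_refl.
  apply: sup_lub => _ [x [y [/h Jxy ->]]].
  apply: (Jxy (fun a b => g^* (fs a) ⊓ b ⊑ y')); last by move=> _ _ [-> ->]; exact: meetr.
  split.
  - move=> a b a' b' hab aa bb; apply: sle_trans hab; apply: meet_mono => //.
    by apply: inv_image_mono; apply: (preserves_sup_mono (left_adjoint_sup adj)).
  - move=> S b hS; rewrite (left_adjoint_sup adj) inv_image_sup meetC meet_sup.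
    by apply: sup_lub => _ [_ [_ [a Sa <-] <-] <-]; rewrite meetC; exact: hS.
  - by move=> a S hS; rewrite meet_sup; apply: sup_lub => _ [b Sb <-]; exact: hS.
  - by move=> a b z; rewrite fr inv_image_meet meetA.
apply: (is_openP psadj) => J y'.
rewrite {1}/ps meetC meet_sup; apply: sup_lub => _ [_ [x [y [Jxy ->]]] <-].
rewrite meetC -meetA; apply: sup_ub; exists x, (y ⊓ y'); split=> //.
apply/opn_meet; split.
  by apply: (pbi_down (opnP J) Jxy); [exact: sle_refl|exact: meetl].
have /tensor_le : tensor f g ⊤ y' ⊑ pb_snd^* y' by exact: sle_refl.
by move=> h; apply: (pbi_down (opnP _) h); [exact: top_max|exact: meetr].
Qed.

(* [s] is the image of a local section of [f] defined on [v]. *)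
Lemma local_homeoP (X Y : locale) (f : cmap X Y) : is_local_homeo f ->
  exists S : set X, ⨆ S = ⊤ /\ forall s, S s -> exists v : Y,
    (forall x, x ⊑ s -> exists2 w, w ⊑ v & x = s ⊓ f^* w) /\
    (forall w w', w ⊑ v -> s ⊓ f^* w ⊑ f^* w' -> w ⊑ w').
Proof.
move=> [S [Stop hS]]; exists S; split=> // s /hS [v [phi [[psi [h1 h2]] e]]].
pose vX (z : open_sub s) : X := sval z.
pose vY (z : open_sub v) : Y := sval z.
pose inX x (xs : x ⊑ s) : open_sub s := exist _ x xs.
pose inY w (wv : w ⊑ v) : open_sub v := exist _ w wv.
have fE w (wv : w ⊑ v) : vX (phi^* (inY w wv)) = s ⊓ f^* w.
  have : f^* w ⊓ s = vX (phi^* ((open_incl v)^* w)).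
    exact: (congr1 (fun t : cmap (open_sub s) Y => vX (t^* w)) e).
  suff -> : (open_incl v)^* w = inY w wv by rewrite meetC => ->.
  by apply: (@sval_inj_sub _ v); exact (meet_idPl wv).
exists v; split=> [x xs|w w' wv le_w].
  exists (vY (psi^* (inX x xs))); first exact (svalP (psi^* (inX x xs))).
  rewrite -(fE _ (svalP (psi^* (inX x xs)))).
  have : vX (phi^* (psi^* (inX x xs))) = x.
    exact: (congr1 (fun t : cmap (open_sub s) (open_sub s) => vX (t^* (inX x xs))) h1).
  have eY : psi^* (inX x xs) = inY _ (svalP (psi^* (inX x xs))).
    exact: (@sval_inj_sub _ v).
  by rewrite -eY => ->.
have ww'v : w ⊓ w' ⊑ v by apply: sle_trans wv; exact: meetl.
suff -> : w = w ⊓ w' by exact: meetr.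
have e' : phi^* (inY w wv) = phi^* (inY _ ww'v).
  apply: (@sval_inj_sub _ s); rewrite -![sval _]/(vX _) !fE inv_image_meet meetA.
  exact/esym/meet_idPl.
have fgE z : psi^* (phi^* z) = z := congr1 (fun t => t^* z) h2.
by have := congr1 (fun t => vY (psi^* t)) e'; rewrite !fgE.
Qed.

Lemma cover_le (X : locale) (S : set X) (x y : X) :
  ⨆ S = ⊤ -> (forall s, S s -> s ⊓ x ⊑ y) -> x ⊑ y.
Proof.
move=> Stop h; rewrite -(meetT x) -Stop meet_sup; apply: sup_lub => _ [s Ss <-].
by rewrite meetC; exact: h.
Qed.

Lemma local_homeo_open (X Y : locale) (f : cmap X Y) : is_local_homeo f -> is_open f.
Proof.
move=> /local_homeoP [S [Stop hS]].
have adj : left_adjoint (direct_image f) f.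
  move=> x y; split=> [h|]; last by move=> h; exact: inf_lb.
  apply: sle_trans (inv_image_mono f h).
  apply: (cover_le Stop) => s /hS [v [hs hv]].
  have [w wv e] := hs _ (meetl s x); rewrite e.
  apply: (sle_trans (meetr _ _)); apply: inv_image_mono; apply: inf_glb => y' xy'.
  by apply: hv => //; rewrite -e; apply: sle_trans xy'; exact: meetr.
apply: (is_openP adj) => x y.
set t := direct_image f (_ ⊓ _).
pose imp := ⨆ [set z | z ⊓ y ⊑ t].
have impP z : z ⊑ imp <-> z ⊓ y ⊑ t.
  split=> [h|h]; last by apply: sup_ub.
  apply: (sle_trans (meet_mono h (sle_refl y))).
  by rewrite meetC meet_sup; apply: sup_lub => _ [z' h' <-]; rewrite meetC.
apply: (proj1 (impP _)); apply/adj; apply: (cover_le Stop) => s /hS [v [hs hv]].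
have [w wv e] := hs _ (meetl s x); rewrite e.
apply: (sle_trans (meetr _ _)); apply: inv_image_mono; apply: (proj2 (impP _)).
apply: inf_glb => y' xy'; apply: hv; first by apply: sle_trans wv; exact: meetl.
rewrite inv_image_meet meetA -e; apply: sle_trans xy'.
by apply: meet_mono; [exact: meetr|exact: sle_refl].
Qed.

Lemma local_homeo_section_open (X Y : locale) (f : cmap X Y) (u : cmap Y X) :
  is_local_homeo f -> f ∘ u = cid_map Y -> is_open u.
Proof.
move=> /local_homeoP [S [Stop hS]] fu.
have fuE y : u^* (f^* y) = y := congr1 (fun t => t^* y) fu.
have Stop' : ⨆ (u^* @` S) = ⊤ by rewrite -inv_image_sup Stop inv_image_top.
pose us (z : Y) : X := ⨆ ((fun s => s ⊓ f^* (z ⊓ u^* s)) @` S).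
have adj : left_adjoint us u.
  move=> z x; split=> [h|h].
    apply: (cover_le Stop') => _ [s Ss <-].
    have {}h : s ⊓ f^* (z ⊓ u^* s) ⊑ x.
      by apply: sle_trans h; apply: sup_ub; exists s.
    apply: sle_trans (inv_image_mono u h); rewrite inv_image_meet fuE.
    by apply: meet_glb; [exact: meetl|rewrite meetC; exact: sle_refl].
  apply: sup_lub => _ [s /hS [v [hs _]] <-].
  have [w wv e] := hs _ (meetl s x).
  apply: (@sle_trans _ _ (s ⊓ x)); last exact: meetr.
  rewrite e; apply: meet_mono; first exact: sle_refl.
  apply: inv_image_mono.
  have e' := congr1 u^* e; rewrite !inv_image_meet fuE in e'.
  apply: (@sle_trans _ _ (u^* s ⊓ w)); last exact: meetr.
  rewrite -e' meetC; apply: meet_mono => //; exact: sle_refl.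
apply: (is_openP adj) => z y.
rewrite {1}/us meetC meet_sup; apply: sup_lub => _ [_ [s Ss <-] <-].
have [v [hs _]] := hS _ Ss.
have [w wv e] := hs _ (meetl s y).
have e' := congr1 u^* e; rewrite !inv_image_meet fuE in e'.
apply: (@sle_trans _ _ (s ⊓ f^* ((z ⊓ u^* y) ⊓ u^* s))); last first.
  by apply: sup_ub; exists s.
have -> : y ⊓ (s ⊓ f^* (z ⊓ u^* s)) = s ⊓ f^* (w ⊓ (z ⊓ u^* s)).
  by rewrite meetA (meetC y) e -meetA -inv_image_meet.
apply: meet_mono; first exact: sle_refl.
apply: inv_image_mono.
have le1 : w ⊓ (z ⊓ u^* s) ⊑ u^* s by apply: (sle_trans (meetr _ _)); exact: meetr.
apply: meet_glb => //; apply: meet_glb.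
  by apply: (sle_trans (meetr _ _)); exact: meetl.
apply: (@sle_trans _ _ (u^* s ⊓ w)); first by apply: meet_glb => //; exact: meetl.
by rewrite -e'; exact: meetr.
Qed.

(* Beck-Chevalley for the maps [h × 1] and [1 × h] with [h] open. *)
Lemma pb_open_left (X X' Y Z : locale) (f : cmap X Z) (g : cmap Y Z)
    (h : cmap X' X) (H : f ∘ (h ∘ pb_fst) = g ∘ (pb_snd : cmap (pullback (f ∘ h) g) Y))
    (I : pullback f g) x' y : is_open h ->
  opn ((pb_pair (h ∘ pb_fst) pb_snd H)^* I) x' y <-> opn I (direct_image h x') y.
Proof.
move=> oh; have adj := direct_image_adj oh; split=> [hI|hI].
  have iJ : pb_ideal (f ∘ h) g (fun a b => opn I (direct_image h a) b).
    split.
    - move=> a b a' b' hab aa bb; apply: (pbi_down (opnP I)) hab _ bb.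
      exact: (preserves_sup_mono (left_adjoint_sup adj)).
    - move=> S b hS; rewrite (left_adjoint_sup adj); apply: (pbi_supl (opnP I)).
      by move=> _ [a Sa <-]; exact: hS.
    - by move=> a S hS; apply: (pbi_supr (opnP I)).
    - by move=> a b z /=; rewrite direct_image_frob //; exact: (pbi_bal (opnP I)).
  pose J : pullback (f ∘ h) g := exist _ _ iJ.
  suff le_J : (pb_pair (h ∘ pb_fst) pb_snd H)^* I ⊑ J by exact: (le_J _ _ hI).
  apply: sup_lub => _ [a [b [Iab ->]]]; apply/pb_le => /=.
  apply: (pbi_down (opnP I) Iab); last exact: sle_refl.
  by apply/adj; exact: sle_refl.
apply/pb_le; apply: (@sle_trans _ _
  ((h ∘ pb_fst)^* (direct_image h x') ⊓ (pb_snd : cmap (pullback (f ∘ h) g) Y)^* y)).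
  apply: meet_mono; last exact: sle_refl.
  by apply: inv_image_mono; apply/adj; exact: sle_refl.
by apply: sup_ub; exists (direct_image h x'), y.
Qed.

Lemma pb_open_right (X Y Y' Z : locale) (f : cmap X Z) (g : cmap Y Z)
    (h : cmap Y' Y) (H : f ∘ (pb_fst : cmap (pullback f (g ∘ h)) X) = g ∘ (h ∘ pb_snd))
    (I : pullback f g) x y' : is_open h ->
  opn ((pb_pair pb_fst (h ∘ pb_snd) H)^* I) x y' <-> opn I x (direct_image h y').
Proof.
move=> oh; have adj := direct_image_adj oh; split=> [hI|hI].
  have iJ : pb_ideal f (g ∘ h) (fun a b => opn I a (direct_image h b)).
    split.
    - move=> a b a' b' hab aa bb; apply: (pbi_down (opnP I)) hab aa _.
      exact: (preserves_sup_mono (left_adjoint_sup adj)).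
    - by move=> S b hS; apply: (pbi_supl (opnP I)).
    - move=> a S hS; rewrite (left_adjoint_sup adj); apply: (pbi_supr (opnP I)).
      by move=> _ [b Sb <-]; exact: hS.
    - move=> a b z /=; rewrite (meetC _ b) direct_image_frob // (meetC (direct_image h b)).
      exact: (pbi_bal (opnP I)).
  pose J : pullback f (g ∘ h) := exist _ _ iJ.
  suff le_J : (pb_pair pb_fst (h ∘ pb_snd) H)^* I ⊑ J by exact: (le_J _ _ hI).
  apply: sup_lub => _ [a [b [Iab ->]]]; apply/pb_le => /=.
  apply: (pbi_down (opnP I) Iab); first exact: sle_refl.
  by apply/adj; exact: sle_refl.
apply/pb_le; apply: (@sle_trans _ _
  ((pb_fst : cmap (pullback f (g ∘ h)) X)^* x ⊓ (h ∘ pb_snd)^* (direct_image h y'))).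
  apply: meet_mono; first exact: sle_refl.
  by apply: inv_image_mono; apply/adj; exact: sle_refl.
by apply: sup_ub; exists x, (direct_image h y').
Qed.

End OpenTheory.

Section GeneralizedArrows.
Variable G : groupoid.
Local Notation d := (gd G).
Local Notation r := (gr G).
Local Notation u := (gu G).
Local Notation i := (gi G).
Local Notation m := (gm G).

Definition gmul (W : locale) (g h : cmap W (G1 G)) (H : r ∘ g = d ∘ h) : cmap W (G1 G) :=
  m ∘ pb_pair g h H.

Lemma gmul_eq W (g h g' h' : cmap W (G1 G)) H H' :
  g = g' -> h = h' -> gmul (g := g) (h := h) H = gmul (g := g') (h := h') H'.
Proof. by move=> e1 e2; congr ccomp; exact: pb_pair_eq. Qed.

Lemma gmul_comp V W (g h : cmap W (G1 G)) H (w : cmap V W) H' :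
  gmul (g := g) (h := h) H ∘ w = gmul (g := g ∘ w) (h := h ∘ w) H'.
Proof. by rewrite /gmul -ccompA; congr ccomp; exact: pb_pair_comp. Qed.

Lemma gmul_d W (g h : cmap W (G1 G)) H : d ∘ gmul (g := g) (h := h) H = d ∘ g.
Proof. by rewrite /gmul ccompA gdm -ccompA pb_fst_pair. Qed.

Lemma gmul_r W (g h : cmap W (G1 G)) H : r ∘ gmul (g := g) (h := h) H = r ∘ h.
Proof. by rewrite /gmul ccompA grm -ccompA pb_snd_pair. Qed.

Lemma gmulA W (f g h : cmap W (G1 G)) H1 H2 H3 H4 :
  gmul (g := gmul (g := f) (h := g) H1) (h := h) H2
  = gmul (g := f) (h := gmul (g := g) (h := h) H3) H4.
Proof.
have Hk : (r ∘ pb_snd) ∘ pb_pair f g H1 = d ∘ h by rewrite -ccompA pb_snd_pair H3.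
have := congr1 (fun t => t ∘ pb_pair (pb_pair f g H1) h Hk) (gmA G).
have E1 : r ∘ (m ∘ pb_fst ∘ pb_pair (pb_pair f g H1) h Hk)
          = d ∘ (pb_snd ∘ pb_pair (pb_pair f g H1) h Hk).
  by rewrite -(ccompA m) pb_fst_pair pb_snd_pair -H2.
have E3 : r ∘ (pb_snd ∘ pb_fst ∘ pb_pair (pb_pair f g H1) h Hk)
          = d ∘ (pb_snd ∘ pb_pair (pb_pair f g H1) h Hk).
  by rewrite -(ccompA pb_snd) pb_fst_pair !pb_snd_pair.
have eI : action_inner d m ∘ pb_pair (pb_pair f g H1) h Hk = gmul H3.
  rewrite /action_inner -ccompA (pb_pair_comp _ E3); congr ccomp; apply: pb_pair_eq.
    by rewrite -(ccompA pb_snd) pb_fst_pair pb_snd_pair.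
  by rewrite pb_snd_pair.
have E2 : r ∘ (pb_fst ∘ pb_fst ∘ pb_pair (pb_pair f g H1) h Hk)
          = d ∘ (action_inner d m ∘ pb_pair (pb_pair f g H1) h Hk).
  by rewrite eI -(ccompA pb_fst) !pb_fst_pair.
rewrite -!ccompA (pb_pair_comp _ E1) (pb_pair_comp _ E2) => e.
etransitivity; last (etransitivity; first exact: e); congr ccomp; apply: pb_pair_eq.
- by rewrite -(ccompA m) pb_fst_pair.
- by rewrite pb_snd_pair.
- by rewrite -(ccompA pb_fst) !pb_fst_pair.
- exact: eI.
Qed.

Lemma gmul1l W (g h : cmap W (G1 G)) H : g = u ∘ d ∘ h -> gmul (g := g) (h := h) H = h.
Proof.
move=> e; subst g; have := congr1 (fun t => t ∘ h) (gm1l G).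
rewrite /action_unit -ccompA.
have E : r ∘ (u ∘ d ∘ h) = d ∘ (cid_map (G1 G) ∘ h).
  by rewrite ccomp_idl !ccompA gru ccomp_idl.
rewrite (pb_pair_comp _ E) => e; rewrite -[RHS]ccomp_idl -e.
by congr ccomp; apply: pb_pair_eq; rewrite ?ccomp_idl.
Qed.

Lemma gmul1r W (g h : cmap W (G1 G)) H : h = u ∘ r ∘ g -> gmul (g := g) (h := h) H = g.
Proof.
move=> e; subst h; have := congr1 (fun t => t ∘ g) (gm1r G).
rewrite -ccompA.
have E : r ∘ (cid_map (G1 G) ∘ g) = d ∘ (u ∘ r ∘ g).
  by rewrite ccomp_idl !ccompA gdu ccomp_idl.
rewrite (pb_pair_comp _ E) => e; rewrite -[RHS]ccomp_idl -e.
by congr ccomp; apply: pb_pair_eq; rewrite ?ccomp_idl.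
Qed.

Lemma gmulV W (g h : cmap W (G1 G)) H :
  h = i ∘ g -> gmul (g := g) (h := h) H = u ∘ d ∘ g.
Proof.
move=> e; subst h; have := congr1 (fun t => t ∘ g) (gmVr G).
rewrite -ccompA.
have E : r ∘ (cid_map (G1 G) ∘ g) = d ∘ (i ∘ g) by rewrite ccomp_idl.
rewrite (pb_pair_comp _ E) => <-.
by congr ccomp; apply: pb_pair_eq; rewrite ?ccomp_idl.
Qed.

Lemma gmulVl W (g h : cmap W (G1 G)) H :
  g = i ∘ h -> gmul (g := g) (h := h) H = u ∘ r ∘ h.
Proof.
move=> e; subst g; have := congr1 (fun t => t ∘ h) (gmVl G).
rewrite -ccompA.
have E : r ∘ (i ∘ h) = d ∘ (cid_map (G1 G) ∘ h) by rewrite ccomp_idl.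
rewrite (pb_pair_comp _ E) => <-.
by congr ccomp; apply: pb_pair_eq; rewrite ?ccomp_idl.
Qed.

Lemma di W (g : cmap W (G1 G)) : d ∘ (i ∘ g) = r ∘ g.
Proof. by rewrite ccompA gdi. Qed.

Lemma ri W (g : cmap W (G1 G)) : r ∘ (i ∘ g) = d ∘ g.
Proof. by rewrite ccompA gri. Qed.

Lemma gmulK W (g h : cmap W (G1 G)) H K :
  gmul (g := i ∘ g) (h := gmul (g := g) (h := h) H) K = h.
Proof.
have E1 : r ∘ (i ∘ g) = d ∘ g by rewrite ri.
have E2 : r ∘ gmul E1 = d ∘ h by rewrite gmul_r.
by rewrite -(gmulA (H1 := E1) E2) gmul1l // gmulVl // -ccompA H ccompA.
Qed.

Lemma gmulVK W (g h : cmap W (G1 G)) H K :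
  gmul (g := g) (h := gmul (g := i ∘ g) (h := h) H) K = h.
Proof.
have E1 : r ∘ g = d ∘ (i ∘ g) by rewrite di.
have E2 : r ∘ gmul E1 = d ∘ h by rewrite gmul_r.
rewrite -(gmulA (H1 := E1) E2) gmul1l // gmulV // -ccompA -ri H; exact: ccompA.
Qed.

Lemma giK : i ∘ i = cid_map (G1 G).
Proof.
have E1 : r ∘ i = d ∘ (i ∘ i) by rewrite di.
have E2 : r ∘ cid_map (G1 G) = d ∘ gmul E1.
  by rewrite gmul_d gdi ccomp_idr.
have E1' : r ∘ (i ∘ cid_map (G1 G)) = d ∘ (i ∘ i) by rewrite ccomp_idr.
have E2' : r ∘ cid_map (G1 G) = d ∘ gmul E1' by rewrite gmul_d di !ccomp_idr.
have := gmulVK (H := E1') E2'; rewrite gmul1r //.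
by rewrite gmulV ?ccomp_idr // -ccompA gdi.
Qed.

Lemma giM W (g h : cmap W (G1 G)) H H' :
  i ∘ gmul (g := g) (h := h) H = gmul (g := i ∘ h) (h := i ∘ g) H'.
Proof.
set gh := gmul H; set hg := gmul H'.
have E0 : r ∘ gh = d ∘ hg by rewrite gmul_r gmul_d di.
have E1 : r ∘ (i ∘ gh) = d ∘ gmul E0 by rewrite ri gmul_d.
rewrite -[hg](gmulK (H := E0) E1) gmul1r //.
have E2 : r ∘ h = d ∘ hg by rewrite gmul_d di.
have E3 : r ∘ g = d ∘ gmul E2 by rewrite gmul_d.
rewrite (gmulA (H3 := E2) E0 E3).
have E4 : r ∘ g = d ∘ (i ∘ g) by rewrite di.
rewrite (gmul_eq E3 E4 erefl (gmulVK _)).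
rewrite gmulV // -(ccompA u) -(ccompA u r) ri; congr ccomp.
by rewrite gmul_d.
Qed.

End GeneralizedArrows.

Section GroupoidQuantale.
Variables (G : groupoid) (etG : etale G).
Local Notation d := (gd G).
Local Notation r := (gr G).
Local Notation u := (gu G).
Local Notation i := (gi G).
Local Notation m := (gm G).
Local Notation G2 := (pullback r d).
Local Notation p1 := (pb_fst : cmap G2 (G1 G)).
Local Notation p2 := (pb_snd : cmap G2 (G1 G)).

Lemma gu_open : is_open u.
Proof. exact: local_homeo_section_open etG (gdu G). Qed.

Lemma gi_open : is_open i.
Proof. by apply: is_open_iso; exists i; rewrite giK. Qed.

(* [m] is, up to the isomorphism [(g, h) |-> (g, gh)], the second projection of
   the pullback of [d] along itself. *)
Lemma gm_open : is_open m.
Proof.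
pose P := pullback d d.
have H : d ∘ p1 = d ∘ m by rewrite gdm.
pose al : cmap G2 P := pb_pair p1 m H.
have K : r ∘ (i ∘ pb_fst) = d ∘ (pb_snd : cmap P (G1 G)) by rewrite ri pb_comm.
have K' : r ∘ (pb_fst : cmap P (G1 G)) = d ∘ gmul K by rewrite gmul_d di.
pose be : cmap P G2 := pb_pair pb_fst (gmul K) K'.
have mE : m = pb_snd ∘ al by rewrite pb_snd_pair.
rewrite {1}mE; apply: is_open_comp.
  exact: is_open_pb_snd (local_homeo_open etG).
apply: is_open_iso; exists be; split.
  apply: pb_jointly_monic; rewrite ccompA ?pb_fst_pair ?pb_snd_pair ccomp_idr //.
  have E : r ∘ ((i ∘ pb_fst) ∘ al) = d ∘ (pb_snd ∘ al).
    by rewrite -(ccompA i) ri /al pb_fst_pair pb_snd_pair.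
  have mI : m = gmul pb_comm by rewrite /gmul pb_pair_id ccomp_idr.
  rewrite (gmul_comp _ E).
  have E' : r ∘ (i ∘ p1) = d ∘ gmul pb_comm by rewrite ri gmul_d.
  have e1 : i ∘ pb_fst ∘ al = i ∘ p1 by rewrite -ccompA pb_fst_pair.
  have e2 : pb_snd ∘ al = gmul pb_comm by rewrite pb_snd_pair -mI.
  by rewrite (gmul_eq E E' e1 e2) gmulK.
apply: pb_jointly_monic; rewrite ccompA ?pb_fst_pair ?pb_snd_pair ccomp_idr //.
exact: gmulVK.
Qed.

(* [a ⊗ b |-> p1^* a ⊓ p2^* b] is the canonical quotient from the frame of
   [G1 × G1] to that of [G2]; [gm_open] makes [direct_image m] the left adjoint
   of [m^*]. *)
Definition gq_mul (a b : G1 G) : G1 G := direct_image m (p1^* a ⊓ p2^* b).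
Definition gq_inv (a : G1 G) : G1 G := direct_image i a.
Definition gq_one : G1 G := direct_image u ⊤.

Lemma gq_mul_le a b t : gq_mul a b ⊑ t <-> opn (m^* t) a b.
Proof. by rewrite -pb_le; exact: (direct_image_adj gm_open). Qed.

Lemma gq_invE a : gq_inv a = i^* a.
Proof.
by rewrite /gq_inv (direct_imageE (fs := i^*)) //; apply: iso_le; exact: giK.
Qed.

Lemma gq_mul_supl b : preserves_sup (fun a => gq_mul a b).
Proof.
move=> S; rewrite /gq_mul inv_image_sup meetC meet_sup image_comp.
rewrite (left_adjoint_sup (direct_image_adj gm_open)) image_comp; congr sup.
by congr image; apply: funext => a; rewrite /gq_mul [p1^* a ⊓ _]meetC.
Qed.

Lemma gq_mul_supr a : preserves_sup (gq_mul a).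
Proof.
move=> S; rewrite /gq_mul inv_image_sup meet_sup image_comp.
by rewrite (left_adjoint_sup (direct_image_adj gm_open)) image_comp.
Qed.

Lemma gq_mulA a b c : gq_mul a (gq_mul b c) = gq_mul (gq_mul a b) c.
Proof.
pose G3l' := pullback (r ∘ m) d; pose G3r' := pullback r (d ∘ m).
have mI : gmul pb_comm = m by rewrite /gmul pb_pair_id ccomp_idr.
have aux (W : locale) (x y z : cmap W (G1 G)) (xy : r ∘ x = d ∘ y) (yz : r ∘ y = d ∘ z)
    K K' (t : G1 G) : (gmul (g := gmul xy) (h := z) K)^* t
    = (gmul (g := x) (h := gmul yz) K')^* t.
  by rewrite (gmulA _ (H3 := yz) K').
have lE t : gq_mul (gq_mul a b) c ⊑ t <->
    forall (W : locale) (x y z : cmap W (G1 G)) (xy : r ∘ x = d ∘ y) K,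
      x^* a ⊓ y^* b ⊓ z^* c ⊑ (gmul (g := gmul xy) (h := z) K)^* t.
  rewrite gq_mul_le; split=> [h W x y z xy K|h].
    have K0 : (r ∘ m) ∘ pb_pair x y xy = d ∘ z by rewrite -K -ccompA.
    have H0 : r ∘ (m ∘ pb_fst) = d ∘ (pb_snd : cmap G3l' (G1 G)).
      by rewrite ccompA pb_comm.
    move/(pb_open_left H0 _ _ _ gm_open)/pb_le: h.
    move/(inv_image_mono (pb_pair (pb_pair x y xy) z K0)).
    rewrite !inv_image_meet.
    have e1 : pb_fst ∘ pb_pair (pb_pair x y xy) z K0 = pb_pair x y xy.
      exact: pb_fst_pair.
    have e2 : pb_snd ∘ pb_pair (pb_pair x y xy) z K0 = z by exact: pb_snd_pair.
    have -> : gmul K = m ∘ pb_pair (m ∘ pb_fst) pb_snd H0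
        ∘ pb_pair (pb_pair x y xy) z K0.
      rewrite -ccompA; congr ccomp; apply: pb_jointly_monic.
        by rewrite pb_fst_pair ccompA pb_fst_pair -ccompA e1.
      by rewrite pb_snd_pair ccompA pb_snd_pair e2.
    have -> : x^* a = (p1 ∘ (pb_fst ∘ pb_pair (pb_pair x y xy) z K0))^* a.
      by rewrite e1 pb_fst_pair.
    have -> : y^* b = (p2 ∘ (pb_fst ∘ pb_pair (pb_pair x y xy) z K0))^* b.
      by rewrite e1 pb_snd_pair.
    by have -> : z^* c = (pb_snd ∘ pb_pair (pb_pair x y xy) z K0)^* c by rewrite e2.
  have H0 : r ∘ (m ∘ pb_fst) = d ∘ (pb_snd : cmap G3l' (G1 G)).
    by rewrite ccompA pb_comm.
  apply/(pb_open_left H0 _ _ _ gm_open)/pb_le.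
  have xy : r ∘ (p1 ∘ (pb_fst : cmap G3l' _)) = d ∘ (p2 ∘ pb_fst).
    by rewrite !ccompA pb_comm.
  have eg : gmul xy = m ∘ pb_fst.
    by rewrite -(gmul_comp pb_comm xy) mI.
  have K : r ∘ gmul xy = d ∘ (pb_snd : cmap G3l' _) by rewrite eg.
  have {h}: pb_fst^* (p1^* a) ⊓ pb_fst^* (p2^* b) ⊓ pb_snd^* c ⊑ (gmul K)^* t.
    exact: (h _ _ _ _ xy K).
  by rewrite (gmul_eq K H0 eg erefl) -inv_image_meet.
have rE t : gq_mul a (gq_mul b c) ⊑ t <->
    forall (W : locale) (x y z : cmap W (G1 G)) (yz : r ∘ y = d ∘ z) K,
      x^* a ⊓ (y^* b ⊓ z^* c) ⊑ (gmul (g := x) (h := gmul yz) K)^* t.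
  rewrite gq_mul_le; split=> [h W x y z yz K|h].
    have K0 : r ∘ x = (d ∘ m) ∘ pb_pair y z yz by rewrite K -ccompA.
    have H0 : r ∘ (pb_fst : cmap G3r' (G1 G)) = d ∘ (m ∘ pb_snd).
      by rewrite ccompA pb_comm.
    move/(pb_open_right H0 _ _ _ gm_open)/pb_le: h.
    move/(inv_image_mono (pb_pair x (pb_pair y z yz) K0)).
    rewrite !inv_image_meet.
    have e1 : pb_fst ∘ pb_pair x (pb_pair y z yz) K0 = x by exact: pb_fst_pair.
    have e2 : pb_snd ∘ pb_pair x (pb_pair y z yz) K0 = pb_pair y z yz.
      exact: pb_snd_pair.
    have -> : gmul K = m ∘ pb_pair pb_fst (m ∘ pb_snd) H0
        ∘ pb_pair x (pb_pair y z yz) K0.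
      rewrite -ccompA; congr ccomp; apply: pb_jointly_monic.
        by rewrite pb_fst_pair ccompA pb_fst_pair e1.
      by rewrite pb_snd_pair ccompA pb_snd_pair -ccompA e2.
    have -> : y^* b = (p1 ∘ (pb_snd ∘ pb_pair x (pb_pair y z yz) K0))^* b.
      by rewrite e2 pb_fst_pair.
    have -> : z^* c = (p2 ∘ (pb_snd ∘ pb_pair x (pb_pair y z yz) K0))^* c.
      by rewrite e2 pb_snd_pair.
    by have -> : x^* a = (pb_fst ∘ pb_pair x (pb_pair y z yz) K0)^* a by rewrite e1.
  have H0 : r ∘ (pb_fst : cmap G3r' (G1 G)) = d ∘ (m ∘ pb_snd).
    by rewrite ccompA pb_comm.
  apply/(pb_open_right H0 _ _ _ gm_open)/pb_le.
  have yz : r ∘ (p1 ∘ (pb_snd : cmap G3r' _)) = d ∘ (p2 ∘ pb_snd).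
    by rewrite !ccompA pb_comm.
  have eg : gmul yz = m ∘ pb_snd.
    by rewrite -(gmul_comp pb_comm yz) mI.
  have K : r ∘ (pb_fst : cmap G3r' _) = d ∘ gmul yz by rewrite eg.
  have {h}: pb_fst^* a ⊓ (pb_snd^* (p1^* b) ⊓ pb_snd^* (p2^* c)) ⊑ (gmul K)^* t.
    exact: (h _ _ _ _ yz K).
  by rewrite (gmul_eq K H0 erefl eg) -inv_image_meet.
apply: eq_sle => t; rewrite lE rE; split=> h W x y z.
- move=> xy K; have yz : r ∘ y = d ∘ z by rewrite -K gmul_r.
  have K' : r ∘ x = d ∘ gmul yz by rewrite gmul_d.
  by rewrite (aux _ _ _ _ _ yz _ K') -meetA; exact: h.
- move=> yz K; have xy : r ∘ x = d ∘ y by rewrite K gmul_d.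
  have K' : r ∘ gmul xy = d ∘ z by rewrite gmul_r.
  by rewrite -(aux _ _ _ _ xy yz K') meetA; exact: h.
Qed.

Lemma gq_mul1l a : gq_mul gq_one a = a.
Proof.
have H : r ∘ (u ∘ pb_fst) = d ∘ (pb_snd : cmap (pullback (r ∘ u) d) (G1 G)).
  by rewrite ccompA pb_comm.
have e : m ∘ pb_pair (u ∘ pb_fst) pb_snd H = pb_snd.
  rewrite -/(gmul H) gmul1l // -ccompA -[LHS]/(u ∘ pb_fst); congr ccomp.
  by rewrite -pb_comm gru ccomp_idl.
apply: eq_sle => t; rewrite gq_mul_le -(pb_open_left H) -?pb_le; last exact: gu_open.
rewrite inv_image_top meetTl.
have -> : (pb_pair (u ∘ pb_fst) pb_snd H)^* (m^* t)
  = (m ∘ pb_pair (u ∘ pb_fst) pb_snd H)^* t by [].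
rewrite e; split=> [h|]; last exact: inv_image_mono.
have K : (r ∘ u) ∘ d = d ∘ cid_map (G1 G) by rewrite gru ccomp_idl ccomp_idr.
have := inv_image_mono (pb_pair d (cid_map (G1 G)) K) h.
have sE x : (pb_pair d (cid_map (G1 G)) K)^* (pb_snd^* x) = x.
  exact: (congr1 (fun t => t^* x) (pb_snd_pair K)).
by rewrite !sE.
Qed.

Lemma gq_mul1r a : gq_mul a gq_one = a.
Proof.
have H : r ∘ (pb_fst : cmap (pullback r (d ∘ u)) (G1 G)) = d ∘ (u ∘ pb_snd).
  by rewrite ccompA pb_comm.
have e : m ∘ pb_pair pb_fst (u ∘ pb_snd) H = pb_fst.
  rewrite -/(gmul H) gmul1r // -ccompA; congr ccomp.
  by rewrite pb_comm gdu ccomp_idl.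
apply: eq_sle => t; rewrite gq_mul_le -(pb_open_right H) -?pb_le; last exact: gu_open.
rewrite inv_image_top meetT.
have -> : (pb_pair pb_fst (u ∘ pb_snd) H)^* (m^* t)
  = (m ∘ pb_pair pb_fst (u ∘ pb_snd) H)^* t by [].
rewrite e; split=> [h|]; last exact: inv_image_mono.
have K : r ∘ cid_map (G1 G) = (d ∘ u) ∘ r by rewrite gdu ccomp_idl ccomp_idr.
have := inv_image_mono (pb_pair (cid_map (G1 G)) r K) h.
have sE x : (pb_pair (cid_map (G1 G)) r K)^* (pb_fst^* x) = x.
  exact: (congr1 (fun t => t^* x) (pb_fst_pair K)).
by rewrite !sE.
Qed.

Lemma gq_invK a : gq_inv (gq_inv a) = a.
Proof. by rewrite !gq_invE; exact: (congr1 (fun t => t^* a) (giK G)). Qed.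

Lemma gq_inv_sup : preserves_sup gq_inv.
Proof. exact: left_adjoint_sup (direct_image_adj gi_open). Qed.

Lemma gq_invM a b : gq_inv (gq_mul a b) = gq_mul (gq_inv b) (gq_inv a).
Proof.
have H : r ∘ (i ∘ p2) = d ∘ (i ∘ p1) by rewrite ri di pb_comm.
pose tau : cmap G2 G2 := pb_pair (i ∘ p2) (i ∘ p1) H.
have t1 : p1 ∘ tau = i ∘ p2 by exact: pb_fst_pair.
have t2 : p2 ∘ tau = i ∘ p1 by exact: pb_snd_pair.
have tauK : tau ∘ tau = cid_map G2.
  apply: pb_jointly_monic; rewrite ccompA ?t1 ?t2 -ccompA ?t1 ?t2 ccompA giK;
    by rewrite ccomp_idl ccomp_idr.
have im : i ∘ m = m ∘ tau.
  have -> : m ∘ tau = gmul H by [].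
  by rewrite -(giM pb_comm) /gmul pb_pair_id ccomp_idr.
apply: eq_sle => t; rewrite gq_invE.
rewrite (iso_le (giK G) (giK G)) /gq_mul !(direct_image_adj gm_open).
have -> : m^* (i^* t) = tau^* (m^* t) by exact: (congr1 (fun z => z^* t) im).
rewrite -(iso_le tauK tauK) inv_image_meet.
have -> : tau^* (p1^* a) = p2^* (gq_inv a).
  by rewrite gq_invE; exact: (congr1 (fun z => z^* a) t1).
have -> : tau^* (p2^* b) = p1^* (gq_inv b).
  by rewrite gq_invE; exact: (congr1 (fun z => z^* b) t2).
by rewrite meetC.
Qed.

Definition groupoid_quantale : uiQuantale :=
  {| uq_sl := G1 G;
     qmul := gq_mul;
     qinv := gq_inv;
     qone := gq_one;
     qmulA := gq_mulA;
     qmul1l := gq_mul1l;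
     qmul1r := gq_mul1r;
     qmul_supl := gq_mul_supl;
     qmul_supr := gq_mul_supr;
     qinvK := gq_invK;
     qinvM := gq_invM;
     qinv_sup := gq_inv_sup |}.

End GroupoidQuantale.

(* Main.v *)
From mathcomp Require Import ssreflect ssrfun ssrbool boolp classical_sets.
Require Import Defs.

Set Implicit Arguments.
Unset Strict Implicit.
Unset Printing Implicit Defensive.

Local Open Scope classical_set_scope.
Local Open Scope locale_scope.

(** Write [e] for the unit of [Q = O(G)] and [B] for the elements below [e].

    Everything rests on two properties of [Q], collected in [inverse_quantale]:
    [a ⊑ a a^* a] for all [a], and every element is a join of partial units,
    i.e. of elements [s] with [s^* s ⊑ e] and [s s^* ⊑ e].  The first is the
    groupoid law [g = g g^-1 g].  The second holds because [G] is étale: the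
    opens on which [d] is injective cover [G1], so do those on which [r = d i]
    is, and an open on which both are injective is a partial unit (see
    [gd_section_inj] and [groupoid_quantale_inverse]).  Their use is always the
    same.  An equation involving the action of [a] has one inequality that is
    formal; the other is proved for partial units [s], because [s^*] undoes [s] up
    to an element of [B], and elements of [B] act by meets; it then extends to all
    of [Q] by taking joins.

    _Q-LH and Q-Sh._  The isomorphism is the identity on objects and sends
    [f : X -> Y] to its direct image.  Since a local section [t] of [Y] satisfies
    [y = ς(y) t] below it, [f^*] has the left adjoint [x |-> ς(x) t] on the
    opens [x ⊑ f^* t], and these are join-dense ([qlh_left_adjoint]).  Conversely
    a sheaf homomorphism [h] preserves joins, hence has a right adjoint, which
    preserves finite meets; it preserves all joins because [h] sends local
    sections to local sections with the same support ([right_adjoint_sup]).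

    _BG and Q-LH._  The action [α] of a G-locale is open, being isomorphic over
    [X] to a pullback of [d] ([gl_act_open]), so that
    [a · x := α_!(π1^* a ⊓ π2^* x)] makes sense.  Writing [u] for the unit map of
    [G], it satisfies [u_!(v) · x = p^* v ⊓ x] ([act_open_base]); from this the
    projection is recovered as [p^* v = u_!(v) · ⊤].  By
    adjunction, [(a, x)] belongs to [α^* t], seen as a set of pairs, exactly when
    [a · x ⊑ t]; this recovers [α], and it is the definition of [α^*] when one
    starts from a Q-sheaf.  That [α^*] then preserves joins is where partial
    units are needed ([qgact_inv_sup]).  Underlying locales never change, so the
    passage is strictly bijective on objects, and a map of locales is equivariant
    exactly when its inverse image is a module homomorphism
    ([equivariant_act], [module_hom_equivariant]). *)

(** * Strict isomorphisms of categories *)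

(** Two functors can agree on objects only up to propositional equality; [hcast]
    transports arrows along such equalities of their endpoints. *)
Definition hcast (C : category) (A A' B B' : C) (eA : A = A') (eB : B = B')
    (f : hom A B) : hom A' B' :=
  match eA in _ = A1, eB in _ = B1 return hom A1 B1 with erefl, erefl => f end.

Lemma hcast_id (C : category) (A A' : C) (e : A = A') :
  hcast e e (idm A) = idm A'.
Proof. by case: A' / e. Qed.

Lemma hcast_comp (C : category) (A A' B B' D D' : C) (eA : A = A') (eB : B = B')
    (eD : D = D') (g : hom B D) (f : hom A B) :
  hcast eA eD (compm g f) = compm (hcast eB eD g) (hcast eA eB f).
Proof. by case: A' / eA; case: B' / eB; case: D' / eD. Qed.

Lemma hcastVK (C : category) (A A' B B' : C) (eA : A = A') (eB : B = B')
    (f : hom A' B') :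
  hcast eA eB (hcast (esym eA) (esym eB) f) = f.
Proof. by move: f; case: A' / eA; case: B' / eB. Qed.

Lemma hcast_fmap (C D : category) (F : functor C D) (A A' B B' : C)
    (eA : A = A') (eB : B = B') (eFA : F A = F A') (eFB : F B = F B')
    (f : hom A B) :
  hcast eFA eFB (fmap F f) = fmap F (hcast eA eB f).
Proof.
case: A' / eA eFA; case: B' / eB eFB => eFB eFA.
by rewrite (Prop_irrelevance eFA erefl) (Prop_irrelevance eFB erefl).
Qed.

Lemma functor_eq (C D : category) (F K : functor C D) (e : forall A, F A = K A) :
  (forall A B (f : hom A B), hcast (e A) (e B) (fmap F f) = fmap K f) -> F = K.
Proof.
case: F K e => [Fo Fm Fi Fc] [Ko Km Ki Kc] /= e.
have eo : Fo = Ko by apply: funext.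
subst Ko => h.
have em : Fm = Km.
  apply: functional_extensionality_dep => A; apply: functional_extensionality_dep => B.
  apply: funext => f; rewrite -h.
  by rewrite (Prop_irrelevance (e A) erefl) (Prop_irrelevance (e B) erefl).
by subst Km; congr Functor; exact: Prop_irrelevance.
Qed.

(** A functor that is bijective on objects and fully faithful has a strict inverse:
    [K] need only be given on objects, and preimages only for arrows between
    objects in the image of [F]. *)
Section IsoOfBijective.
Variables (C D : category) (F : functor C D) (K : D -> C).
Hypotheses (KF : forall A, K (F A) = A) (FK : forall A, F (K A) = A).
Variable lift : forall A B : C, hom (F A) (F B) -> hom A B.
Hypotheses (fmapK : forall A B (f : hom A B), lift (fmap F f) = f).
Hypotheses (liftK : forall A B (g : hom (F A) (F B)), fmap F (lift g) = g).

Let inv_fmap (A B : D) (g : hom A B) : hom (K A) (K B) :=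
  lift (hcast (esym (FK A)) (esym (FK B)) g).

Let inv_fmap_id A : inv_fmap (idm A) = idm (K A).
Proof. by rewrite /inv_fmap hcast_id -fmap_id fmapK. Qed.

Let inv_fmap_comp (A B E : D) (g : hom B E) (f : hom A B) :
  inv_fmap (compm g f) = compm (inv_fmap g) (inv_fmap f).
Proof.
by rewrite -[RHS]fmapK fmap_comp !liftK /inv_fmap (hcast_comp _ (esym (FK B))).
Qed.

Let inv_functor : functor D C := Functor inv_fmap_id inv_fmap_comp.

Lemma isomorphic_of_bijective : isomorphic_categories C D.
Proof.
exists F, inv_functor; split.
  apply: (@functor_eq _ _ (functor_comp inv_functor F) (functor_id C) KF) => A B f /=.
  rewrite /inv_fmap (hcast_fmap (esym (KF A)) (esym (KF B))) fmapK; exact: hcastVK.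
apply: (@functor_eq _ _ (functor_comp F inv_functor) (functor_id D) FK) => A B f /=.
rewrite /inv_fmap liftK; exact: hcastVK.
Qed.

End IsoOfBijective.

(** * Join-dense sets *)

Definition join_dense (L : supLattice) (P : set L) : Prop :=
  forall x, x = ⨆ [set s | P s /\ s ⊑ x].

(** The workhorse for reducing inequalities to generators; only the smaller side
    has to preserve joins. *)
Lemma join_dense_le (L M : supLattice) (P : set L) (f g : L -> M) :
  join_dense P -> preserves_sup f -> {homo g : x y / x ⊑ y} ->
  (forall s, P s -> f s ⊑ g s) -> forall x, f x ⊑ g x.
Proof.
move=> dP fsup gmono h x; rewrite {1}(dP x) fsup.
by apply: sup_lub => _ [s [Ps sx] <-]; apply: sle_trans (gmono _ _ sx); exact: h.
Qed.

Lemma cover_join_dense (X : locale) (P : set X) :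
  (forall s t, P t -> s ⊑ t -> P s) -> ⨆ P = ⊤ -> join_dense P.
Proof.
move=> Pdown Ptop x; apply: sle_anti; last by apply: sup_lub => s [].
apply: (cover_le Ptop) => s Ps; apply: sup_ub; split; last exact: meetr.
exact: Pdown Ps (meetl _ _).
Qed.

Lemma preserves_sup_id (L : supLattice) : preserves_sup (fun x : L => x).
Proof. by move=> S; rewrite image_id. Qed.

Lemma preserves_sup_comp (L M N : supLattice) (g : M -> N) (f : L -> M) :
  preserves_sup g -> preserves_sup f -> preserves_sup (fun x => g (f x)).
Proof. by move=> hg hf S; rewrite hf hg image_comp. Qed.

Lemma preserves_sup_meetl (X : locale) (y : X) : preserves_sup (fun x : X => x ⊓ y).
Proof.
move=> S; rewrite meetC meet_sup; congr sup; congr image.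
by apply: funext => x; rewrite meetC.
Qed.

(** * Inverse quantales *)

Section InverseQuantales.
Variable Q : uiQuantale.
Local Notation e := (qone Q).

(** For the quantale of a groupoid these are the local bisections. *)
Definition partial_unit : set Q :=
  [set s | qmul (qinv s) s ⊑ e /\ qmul s (qinv s) ⊑ e].

Record inverse_quantale : Prop := InverseQuantale {
  gelfand : forall a : Q, a ⊑ qmul (qmul a (qinv a)) a;
  partial_unit_dense : join_dense partial_unit
}.

Lemma qinv_mono (a b : Q) : a ⊑ b -> qinv a ⊑ qinv b.
Proof. exact: preserves_sup_mono (@qinv_sup Q) _ _. Qed.

Lemma qinv_one : qinv e = e.
Proof. by rewrite -[LHS]qmul1l -{1}(qinvK e) -qinvM qmul1l qinvK. Qed.

Lemma qinv_base (b : Q) : b ⊑ e -> qinv b ⊑ e.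
Proof. by move=> be; rewrite -qinv_one; exact: qinv_mono. Qed.

Lemma qmul_basel (b a : Q) : b ⊑ e -> qmul b a ⊑ a.
Proof. by move=> be; rewrite -[X in _ ⊑ X]qmul1l; apply: qmul_mono => //; exact: sle_refl. Qed.

Lemma qmul_baser (b a : Q) : b ⊑ e -> qmul a b ⊑ a.
Proof. by move=> be; rewrite -[X in _ ⊑ X]qmul1r; apply: qmul_mono => //; exact: sle_refl. Qed.

Lemma partial_unit_down (s t : Q) : partial_unit t -> s ⊑ t -> partial_unit s.
Proof.
by move=> [t1 t2] st; split; [apply: sle_trans t1|apply: sle_trans t2];
  apply: qmul_mono => //; exact: qinv_mono.
Qed.

Lemma partial_unit_inv (s : Q) : partial_unit s -> partial_unit (qinv s).
Proof. by case=> s1 s2; split; rewrite qinvK. Qed.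

Hypothesis invQ : inverse_quantale.

(** Elements of [B] are idempotent, since [b ⊑ b b^* b ⊑ b b].  Therefore their
    product is their meet, they commute, and they are self-adjoint. *)
Lemma qmul_base_idem (b : Q) : b ⊑ e -> qmul b b = b.
Proof.
move=> be; apply: sle_anti; first exact: qmul_basel.
apply: (sle_trans (gelfand invQ b)); apply: qmul_mono; last exact: sle_refl.
exact: qmul_baser (qinv_base be).
Qed.

Lemma qmul_base (b c : Q) : b ⊑ e -> c ⊑ e -> qmul b c = b ⊓ c.
Proof.
move=> be ce; apply: sle_anti.
  by apply: meet_glb; [exact: qmul_baser|exact: qmul_basel].
rewrite -[X in X ⊑ _]qmul_base_idem; last exact: sle_trans (meetl _ _) be.
by apply: qmul_mono; [exact: meetl|exact: meetr].
Qed.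

Lemma qmul_baseC (b c : Q) : b ⊑ e -> c ⊑ e -> qmul b c = qmul c b.
Proof. by move=> be ce; rewrite !qmul_base // meetC. Qed.

Lemma qinv_base_id (b : Q) : b ⊑ e -> qinv b = b.
Proof.
have aux c : c ⊑ e -> c ⊑ qinv c.
  move=> ce; apply: (sle_trans (gelfand invQ c)).
  by apply: (sle_trans (qmul_baser _ ce)); exact: qmul_basel.
move=> be; apply: sle_anti; last exact: aux.
by rewrite -{2}(qinvK b); apply: aux; exact: qinv_base.
Qed.

Lemma partial_unitK (s : Q) : partial_unit s -> qmul (qmul s (qinv s)) s = s.
Proof. by case=> _ s2; apply: sle_anti; [exact: qmul_basel|exact: gelfand]. Qed.

End InverseQuantales.

(** * Quantale locales *)

Section QLocales.
Variables (Q : uiQuantale) (X : qlocale Q).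
Implicit Types (a b : Q) (x y : X).
Local Notation e := (qone Q).

Lemma qact_mono a b x y : a ⊑ b -> x ⊑ y -> a · x ⊑ b · y.
Proof.
move=> ab xy; apply: (@sle_trans _ _ (b · x)).
  exact: (preserves_sup_mono (qact_supl (ql_mod X) x)).
exact: (preserves_sup_mono (qact_supr (ql_mod X) b)).
Qed.

Lemma qact_monor a x y : x ⊑ y -> a · x ⊑ a · y.
Proof. by move=> xy; apply: qact_mono => //; exact: sle_refl. Qed.

Lemma qact_base_le b x : b ⊑ e -> b · x ⊑ x.
Proof. by move=> /(ql_base x) ->; exact: meetr. Qed.

Lemma qact_mulE a b x : a · (b · x) = qmul a b · x.
Proof. by rewrite qactA. Qed.

Lemma partial_unit_invK s x : partial_unit s -> qinv s · (s · x) ⊑ x.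
Proof. by case=> s1 _; rewrite qact_mulE; exact: qact_base_le. Qed.

Lemma partial_unit_Kinv s x : partial_unit s -> s · (qinv s · x) ⊑ x.
Proof. by case=> _ s2; rewrite qact_mulE; exact: qact_base_le. Qed.

Variables (s : X -> Q) (hs : is_support s).

Lemma support_mono x y : x ⊑ y -> s x ⊑ s y.
Proof. exact: preserves_sup_mono (support_sup hs) _ _. Qed.

Lemma support_act_le b x : b ⊑ e -> s (b · x) ⊑ b.
Proof.
move=> be; rewrite (support_act hs) //; exact: qmul_baser (support_base hs x).
Qed.

End QLocales.

Section QSheaves.
Variables (Q : uiQuantale) (X : qsheaf Q).
Implicit Types (b : Q) (x s t : X).
Local Notation supp := (support (qs_open X)).
Local Notation sec := (local_section (qs_open X)).
Local Notation suppP := (supportP (qs_open X)).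

Lemma supp_base x : supp x ⊑ qone Q.
Proof. exact: (support_base suppP x). Qed.

Lemma suppK x : supp x · x = x.
Proof. exact: (support_self suppP x). Qed.

(** With [x ⊑ s ⊑ t] one has [x = ς(x) x ⊑ ς(x) s ⊑ ς(x) t = x]. *)
Lemma local_section_down s t : sec t -> s ⊑ t -> sec s.
Proof.
move=> tsec st x xs; apply: sle_anti; last first.
  by rewrite [X in _ ⊑ X](tsec _ (sle_trans xs st)); exact: qact_monor.
by rewrite -{1}(suppK x); exact: qact_monor.
Qed.

Lemma local_section_dense : join_dense sec.
Proof. apply: cover_join_dense; [exact: local_section_down|exact: qs_cover]. Qed.

End QSheaves.

(** * Direct images of maps of sheaves *)

Section DirectImage.
Variables (Q : uiQuantale) (invQ : inverse_quantale Q).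
Variables (X Y : qsheaf Q) (f : qlh_hom X Y).
Implicit Types (x : X) (y t : Y).
Local Notation e := (qone Q).
Local Notation sX := (support (qs_open X)).
Local Notation sY := (support (qs_open Y)).
Local Notation secX := (local_section (qs_open X)).
Local Notation secY := (local_section (qs_open Y)).
Local Notation sXP := (supportP (qs_open X)).
Local Notation sYP := (supportP (qs_open Y)).
Local Notation dim := (direct_image f).

Lemma support_inv_image_le y : sX (f^* y) ⊑ sY y.
Proof.
by rewrite -{1}(suppK y) qlh_act; apply: (support_act_le sXP); exact: supp_base.
Qed.

(** The opens on which the direct image can be computed from a single section of
    [Y]; they are join-dense because the sections of [Y] cover [Y]. *)
Let small : set X := [set x | exists2 t, secY t & x ⊑ f^* t].

Let small_dense : join_dense small.
Proof.
apply: cover_join_dense.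
  by move=> x x' [t ht x't] xx'; exists t => //; exact: sle_trans x't.
apply: top_eq; rewrite -(inv_image_top f) -(qs_cover Y) inv_image_sup.
apply: sup_lub => _ [t ht <-]; apply: sup_ub; exists t => //; exact: sle_refl.
Qed.

(** If [x ⊑ f^* y], then [x ⊑ f^* (y ⊓ t)], so the support of [x] is at most that
    of [y ⊓ t], which acts on [t] with value [y ⊓ t]. *)
Let small_adj x t : secY t -> x ⊑ f^* t -> forall y, sX x · t ⊑ y <-> x ⊑ f^* y.
Proof.
move=> ht xt y; split=> [/(inv_image_mono f)|xy].
  by apply: sle_trans; rewrite qlh_act -{1}(suppK x); exact: qact_monor.
have yt : x ⊑ f^* (y ⊓ t) by rewrite inv_image_meet; exact: meet_glb.
apply: (sle_trans _ (meetl y t)).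
rewrite [X in _ ⊑ X](ht _ (meetr y t)); apply: qact_mono; last exact: sle_refl.
apply: (sle_trans (support_mono sXP yt)); exact: support_inv_image_le.
Qed.

Let direct_image_small x t : secY t -> x ⊑ f^* t -> dim x = sX x · t.
Proof.
move=> ht xt; apply: sle_anti; first by apply: inf_lb; apply/(small_adj ht xt); exact: sle_refl.
by apply: inf_glb => y xy; exact/(small_adj ht xt).
Qed.

Lemma qlh_left_adjoint : left_adjoint dim f.
Proof.
move=> x y; split=> [xy|xy]; last exact: inf_lb.
apply: sle_trans (inv_image_mono f xy).
apply: (join_dense_le (f := id) (g := fun x => f^* (dim x)) small_dense).
- exact: preserves_sup_id.
- move=> x1 x2 le12; apply: inv_image_mono; apply: inf_glb => y' le2.
  by apply: inf_lb; exact: sle_trans le2.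
- move=> x' [t ht x't]; rewrite (direct_image_small ht x't).
  by apply/(small_adj ht x't); exact: sle_refl.
Qed.

(** Frobenius: for [x ⊑ f^* t], the meet [z = f_! x ⊓ y] lies below [t], so
    [z = ς(z) t], and [x ⊓ f^* y] contains [ς(z) x], whose support is [ς(z)]. *)
Lemma qlh_is_open : is_open f.
Proof.
apply: (is_openP qlh_left_adjoint) => x y.
have dsup := left_adjoint_sup qlh_left_adjoint.
apply: (join_dense_le (f := fun x => dim x ⊓ y) (g := fun x => dim (x ⊓ f^* y)) small_dense).
- exact: preserves_sup_comp (preserves_sup_meetl y) dsup.
- move=> x1 x2 le12; apply: (preserves_sup_mono dsup).
  by apply: meet_mono => //; exact: sle_refl.
move=> x' [t ht x't].
have xy't : x' ⊓ f^* y ⊑ f^* t by apply: sle_trans x't; exact: meetl.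
rewrite (direct_image_small ht x't) (direct_image_small ht xy't).
set z := _ ⊓ y.
have zb : sY z ⊑ sX x'.
  apply: (sle_trans (support_mono sYP (meetl _ _))).
  by apply: (support_act_le sYP); exact: supp_base.
have zt : z ⊑ t by apply: (sle_trans (meetl _ _)); apply: qact_base_le; exact: supp_base.
rewrite (ht _ zt); apply: qact_mono; last exact: sle_refl.
have le_m : sY z · x' ⊑ x' ⊓ f^* y.
  apply: meet_glb; first by apply: qact_base_le; exact: supp_base.
  apply: (@sle_trans _ _ (f^* z)); last by apply: inv_image_mono; exact: meetr.
  by rewrite [in X in _ ⊑ X](ht _ zt) qlh_act; exact: qact_monor.
apply: sle_trans (support_mono sXP le_m); rewrite (support_act sXP); last exact: supp_base.
rewrite -{1}(qmul_base_idem invQ (supp_base z)); apply: qmul_mono => //; exact: sle_refl.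
Qed.

Lemma direct_image_sup : preserves_sup dim.
Proof. exact: left_adjoint_sup qlh_left_adjoint. Qed.

Let direct_image_base b x : b ⊑ e -> dim (b · x) = b · dim x.
Proof.
move=> be; rewrite (ql_base _ be) meetC -(inv_image_top f) -qlh_act.
by rewrite (direct_image_frob qlh_is_open) meetC -ql_base.
Qed.

(** Half of equivariance is formal, by adjunction from that of [f^*]. *)
Let direct_image_lax a x : dim (a · x) ⊑ a · dim x.
Proof.
apply/qlh_left_adjoint; rewrite qlh_act; apply: qact_monor.
by apply/qlh_left_adjoint; exact: sle_refl.
Qed.

(** On a partial unit the other half is
    [s f_! x = s f_!(s^* s x) ⊑ s s^* f_!(s x) ⊑ f_!(s x)]. *)
Lemma direct_image_act a x : dim (a · x) = a · dim x.
Proof.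
apply: sle_anti => //.
apply: (join_dense_le (f := fun a => a · dim x) (g := fun a => dim (a · x))
  (partial_unit_dense invQ)).
- exact: qact_supl.
- move=> a1 a2 le12; apply: (preserves_sup_mono direct_image_sup).
  by apply: qact_mono => //; exact: sle_refl.
move=> s hs; have [s1 s2] := hs.
rewrite -{1}(partial_unitK invQ hs) -qmulA qactA -(direct_image_base _ s1).
rewrite qactA; apply: sle_trans (partial_unit_Kinv _ hs); apply: qact_monor.
exact: direct_image_lax.
Qed.

Lemma direct_image_support x : sY (dim x) = sX x.
Proof.
have dsup := preserves_sup_comp (support_sup sYP) direct_image_sup.
apply: sle_anti.
  apply: (join_dense_le (f := fun x => sY (dim x)) (g := sX) small_dense dsup).
    exact: support_mono sXP.
  move=> x' [t ht x't]; rewrite (direct_image_small ht x't).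
  by apply: (support_act_le sYP); exact: supp_base.
apply: (join_dense_le (f := sX) (g := fun x => sY (dim x)) small_dense (support_sup sXP)).
  exact: preserves_sup_mono dsup.
move=> x' [t ht x't]; rewrite (direct_image_small ht x't) (support_act sYP); last exact: supp_base.
rewrite -{1}(qmul_base_idem invQ (supp_base x')).
apply: qmul_mono; first exact: sle_refl.
by apply: (sle_trans (support_mono sXP x't)); exact: support_inv_image_le.
Qed.

(** By Frobenius, [y ⊑ f_! s] is the direct image of [s ⊓ f^* y], which the section
    [s] reproduces from its support. *)
Lemma direct_image_section s : secX s -> secY (dim s).
Proof.
move=> hs y ys.
have yE : y = dim (s ⊓ f^* y).
  by rewrite (direct_image_frob qlh_is_open) meetC (meet_idPl ys).
rewrite {1}yE {1}(hs _ (meetl s (f^* y))) direct_image_act.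
by rewrite -direct_image_support -yE.
Qed.

End DirectImage.

(** * Maps of sheaves from sheaf homomorphisms *)

Section RightAdjoint.
Variables (Q : uiQuantale) (invQ : inverse_quantale Q).
Variables (X Y : qsheaf Q) (h : qsh_hom X Y).
Local Notation e := (qone Q).
Local Notation sX := (support (qs_open X)).
Local Notation sY := (support (qs_open Y)).

Definition right_adjoint (y : Y) : X := ⨆ [set x | h x ⊑ y].

Lemma right_adjointP x y : h x ⊑ y <-> x ⊑ right_adjoint y.
Proof.
split=> [hxy|xy]; first exact: sup_ub.
apply: (sle_trans (preserves_sup_mono (@qsh_sup _ _ _ h) xy)).
by rewrite qsh_sup; apply: sup_lub => _ [z hz <-].
Qed.

Let right_adjoint_mono y y' : y ⊑ y' -> right_adjoint y ⊑ right_adjoint y'.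
Proof.
move=> yy'; apply/right_adjointP; apply: sle_trans yy'.
exact/right_adjointP/sle_refl.
Qed.

Lemma right_adjoint_meet y y' : right_adjoint (y ⊓ y') = right_adjoint y ⊓ right_adjoint y'.
Proof.
apply: sle_anti.
  by apply: meet_glb; apply: right_adjoint_mono; [exact: meetl|exact: meetr].
apply/right_adjointP; apply: meet_glb; apply/right_adjointP; [exact: meetl|exact: meetr].
Qed.

Lemma right_adjoint_top : right_adjoint ⊤ = ⊤.
Proof. by apply: top_eq; apply/right_adjointP; exact: top_max. Qed.

(** Let [x] be a local section with [h x ⊑ ⨆ S].  As [h x] is a local section, each
    [h x ⊓ y] is [h (ς(h x ⊓ y) x)], so that [ς(h x ⊓ y) x] lies below the right
    adjoint of [y]; since [ς(h x) = ς(x)], these elements join to [x]. *)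
Lemma right_adjoint_sup : preserves_sup right_adjoint.
Proof.
move=> S; apply: sle_anti; last first.
  by apply: sup_lub => _ [y Sy <-]; apply: right_adjoint_mono; exact: sup_ub.
have key x : local_section (qs_open X) x -> h x ⊑ ⨆ S -> x ⊑ ⨆ (right_adjoint @` S).
  move=> xsec hx.
  have hsec := qsh_section (q := h) xsec.
  have hxE : h x = ⨆ ((fun y => h x ⊓ y) @` S) by rewrite -meet_sup (meet_idPl hx).
  rewrite -{1}(suppK x) -(qsh_support h) hxE (support_sup (supportP _)) qact_supl.
  apply: sup_lub => _ [_ [_ [y Sy <-] <-] <-].
  apply: (@sle_trans _ _ (right_adjoint y)); last by apply: sup_ub; exists y.
  apply/right_adjointP; rewrite qsh_act -(hsec _ (meetl (h x) y)); exact: meetr.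
rewrite {1}(local_section_dense (right_adjoint _)).
apply: sup_lub => x [xsec /right_adjointP xS]; exact: key.
Qed.

Definition right_adjoint_map : cmap X Y :=
  CMap right_adjoint_sup right_adjoint_meet right_adjoint_top.

(** On a partial unit [s], with [x] the right adjoint of [s y]: as [h] preserves
    supports, [h x ⊑ s y] gives [ς(x) ⊑ s s^*], hence [x ⊑ s s^* x], while
    [h (s^* x) ⊑ s^* s y ⊑ y]. *)
Lemma right_adjoint_act a y : right_adjoint (a · y) = a · right_adjoint y.
Proof.
apply: sle_anti; last first.
  apply/right_adjointP; rewrite qsh_act; apply: qact_monor.
  exact/right_adjointP/sle_refl.
have dsup : preserves_sup (fun a => right_adjoint (a · y)).
  exact: preserves_sup_comp right_adjoint_sup (qact_supl (ql_mod Y) y).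
apply: (join_dense_le (g := fun a => a · right_adjoint y) (partial_unit_dense invQ) dsup).
  by move=> a1 a2 le12; apply: qact_mono => //; exact: sle_refl.
move=> s hs; have [s1 s2] := hs.
have /right_adjointP := sle_refl (right_adjoint (s · y)).
set x := right_adjoint (s · y) => xs.
have le_ss : sX x ⊑ qmul s (qinv s).
  rewrite -(qsh_support h); apply: (sle_trans (support_mono (supportP _) xs)).
  rewrite -{1}(partial_unitK invQ hs) qactA; exact: (support_act_le (supportP _)).
apply: (@sle_trans _ _ (s · (qinv s · x))).
  by rewrite -{1}(suppK x) qact_mulE; apply: qact_mono => //; exact: sle_refl.
apply: qact_monor; apply/right_adjointP; rewrite qsh_act.
by apply: (sle_trans (qact_monor _ xs)); exact: partial_unit_invK.
Qed.

Definition right_adjoint_hom : qlh_hom X Y :=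
  QLHHom (qlh_map := right_adjoint_map) right_adjoint_act.

Lemma right_adjoint_left_adjoint : left_adjoint h right_adjoint_map.
Proof. exact: right_adjointP. Qed.

End RightAdjoint.

Section QLHQSh.
Variables (Q : uiQuantale) (invQ : inverse_quantale Q).

Definition direct_image_hom (X Y : qsheaf Q) (f : qlh_hom X Y) : qsh_hom X Y :=
  {| qsh_fun := direct_image f;
     qsh_sup := direct_image_sup f;
     qsh_act := direct_image_act invQ f;
     qsh_support := direct_image_support invQ f;
     qsh_section := direct_image_section invQ (f := f) |}.

Lemma direct_image_id X : direct_image_hom (idm (X : QLH Q)) = idm (X : QSh Q).
Proof. by apply: qsh_hom_eq => /=; apply: direct_imageE. Qed.

Lemma direct_image_comp (X Y Z : QLH Q) (g : hom Y Z) (f : hom X Y) :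
  direct_image_hom (compm g f)
  = compm (direct_image_hom g : hom (Y : QSh Q) Z) (direct_image_hom f).
Proof.
apply: qsh_hom_eq => /=; apply: direct_imageE => x z.
by rewrite (qlh_left_adjoint g) (qlh_left_adjoint f).
Qed.

Definition direct_image_functor : functor (QLH Q) (QSh Q) :=
  @Functor (QLH Q) (QSh Q) id direct_image_hom direct_image_id direct_image_comp.

Lemma QLH_isomorphic_QSh : isomorphic_categories (QLH Q) (QSh Q).
Proof.
apply: (@isomorphic_of_bijective _ _ direct_image_functor id _ _
  (fun X Y (h : qsh_hom X Y) => right_adjoint_hom invQ h)) => //= X Y.
  move=> f; apply: qlh_hom_eq; apply: cmap_eq => y /=; apply: sle_anti.
    by apply: sup_lub => x /(qlh_left_adjoint f).
  by apply/right_adjointP/(qlh_left_adjoint f)/sle_refl.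
move=> h; apply: qsh_hom_eq => /=; apply: direct_imageE.
exact: right_adjoint_left_adjoint.
Qed.

End QLHQSh.

(** * Open sublocales, local homeomorphisms and pullbacks *)

Lemma open_incl_top (X : locale) (t : X) : (open_incl t)^* t = ⊤.
Proof. by apply: top_eq; rewrite /= meet_id; exact: (svalP (top (open_sub_sl t))). Qed.

(** An inclusion [t ⊑ y] may be tested by restricting to the open sublocale [t]; this
    allows reasoning with generalized elements that live on [t]. *)
Lemma open_incl_topP (X : locale) (t y : X) : (open_incl t)^* y = ⊤ -> t ⊑ y.
Proof.
move=> e; apply: (@sle_trans _ _ (sval ((open_incl t)^* y))); last exact: meetl.
rewrite e; pose tt : open_sub t := exist (fun z => z ⊑ t) t (sle_refl t).
exact: (top_max tt).
Qed.

Lemma is_iso_of_bij (X Y : locale) (f : cmap X Y) :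
  (forall y y', f^* y = f^* y' -> y = y') -> (forall x, exists y, f^* y = x) ->
  is_iso f.
Proof.
move=> finj fsurj; have [g gK] := choice fsurj.
have gsup : preserves_sup g.
  move=> S; apply: finj; rewrite gK inv_image_sup image_comp; congr sup.
  by rewrite -[LHS]image_id; congr image; apply: funext => x /=; rewrite gK.
have gmeet x y : g (x ⊓ y) = g x ⊓ g y by apply: finj; rewrite inv_image_meet !gK.
have gtop : g ⊤ = ⊤ by apply: finj; rewrite gK inv_image_top.
exists (CMap gsup gmeet gtop); split; apply: cmap_eq => x /=; first exact: gK.
by apply: finj; rewrite gK.
Qed.

Section LocalHomeoOfSections.
Variables (X Y : locale) (f : cmap X Y).

Section Piece.
Variables (s : X) (v : Y) (sv : s ⊑ f^* v).

Definition restrict_inv (w : open_sub v) : open_sub s :=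
  exist (fun x => x ⊑ s) (s ⊓ f^* (sval w)) (meetl _ _).

Lemma restrict_inv_sup : preserves_sup restrict_inv.
Proof.
move=> S; apply: sval_inj_sub => /=; rewrite inv_image_sup meet_sup !image_comp.
by congr sup.
Qed.

Lemma restrict_inv_meet w w' : restrict_inv (w ⊓ w') = restrict_inv w ⊓ restrict_inv w'.
Proof.
apply: sval_inj_sub; rewrite open_sub_meet.
rewrite -[sval (restrict_inv (w ⊓ w'))]/(s ⊓ f^* (sval (w ⊓ w'))).
by rewrite open_sub_meet inv_image_meet /= meetACA meet_id.
Qed.

Lemma restrict_inv_top : restrict_inv ⊤ = ⊤.
Proof.
apply: top_eq => /=; apply: meet_glb; first exact: (svalP (top (open_sub_sl s))).
apply: (sle_trans (svalP (top (open_sub_sl s)))); apply: (sle_trans sv).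
apply: inv_image_mono; pose vv : open_sub v := exist (fun z => z ⊑ v) v (sle_refl v).
exact: (top_max vv).
Qed.

Definition restrict_map : cmap (open_sub s) (open_sub v) :=
  CMap restrict_inv_sup restrict_inv_meet restrict_inv_top.

Lemma restrict_map_incl : f ∘ open_incl s = open_incl v ∘ restrict_map.
Proof.
apply: cmap_eq => y; apply: sval_inj_sub => /=; rewrite inv_image_meet meetC.
by rewrite (meetC (f^* y)) meetA (meet_idPl sv).
Qed.

End Piece.

(** Converse of [local_homeoP]: its two conditions say that [w |-> s ⊓ f^* w] is a
    bijection between the opens below [v] and those below [s]. *)
Lemma local_homeo_of_sections (S : set X) : ⨆ S = ⊤ ->
  (forall s, S s -> exists v : Y,
    (forall x, x ⊑ s -> exists2 w, w ⊑ v & x = s ⊓ f^* w) /\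
    (forall w w', w ⊑ v -> s ⊓ f^* w ⊑ f^* w' -> w ⊑ w')) ->
  is_local_homeo f.
Proof.
move=> Stop hS; exists S; split=> // s /hS [v [h1 h2]].
have sv : s ⊑ f^* v.
  have [w wv ->] := h1 _ (sle_refl s); apply: (sle_trans (meetr _ _)).
  exact: inv_image_mono.
exists v, (restrict_map sv); split; last exact: restrict_map_incl.
have aux (w w' : open_sub v) : (restrict_map sv)^* w = (restrict_map sv)^* w' ->
    sval w ⊑ sval w'.
  move=> /(congr1 sval) /= e; apply: h2; first exact: (svalP w).
  by rewrite e; exact: meetr.
apply: is_iso_of_bij => [w w' e|[x xs]].
  by apply: sval_inj_sub; apply: sle_anti; exact: aux.
have [w wv e] := h1 _ xs; exists (exist (fun z => z ⊑ v) w wv).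
by apply: sval_inj_sub; exact: esym e.
Qed.

End LocalHomeoOfSections.

Lemma inv_image_sup_meet_le (V W : locale) (f : cmap V W) (S : set W) (x y : V) :
  (forall w, S w -> f^* w ⊓ x ⊑ y) -> f^* (⨆ S) ⊓ x ⊑ y.
Proof.
move=> h; rewrite inv_image_sup preserves_sup_meetl image_comp.
by apply: sup_lub => _ [w Sw <-]; exact: h.
Qed.

Section PairLe.
Variables (X Y Z W : locale) (f : cmap X Z) (g : cmap Y Z).
Variables (h : cmap W X) (k : cmap W Y) (hk : f ∘ h = g ∘ k).

Lemma pb_pair_ge (I : pullback f g) x y : opn I x y -> h^* x ⊓ k^* y ⊑ (pb_pair h k hk)^* I.
Proof. by move=> Ixy; apply: sup_ub; exists x, y. Qed.

Lemma pb_pair_meetr_le (I : pullback f g) w t :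
  (forall x y, opn I x y -> w ⊓ (h^* x ⊓ k^* y) ⊑ t) -> w ⊓ (pb_pair h k hk)^* I ⊑ t.
Proof.
move=> H; rewrite /= meet_sup; apply: sup_lub => _ [_ [x [y [Ixy ->]]] <-]; exact: H.
Qed.

Lemma pb_pair_le (I : pullback f g) t :
  (forall x y, opn I x y -> h^* x ⊓ k^* y ⊑ t) -> (pb_pair h k hk)^* I ⊑ t.
Proof. by move=> H; apply: sup_lub => _ [x [y [Ixy ->]]]; exact: H. Qed.

End PairLe.


(** * Generalized elements of a groupoid action *)

(** A map [W -> X] is treated as an element of [X] at stage [W].  The action axioms
    then read as the usual identities between elements, and the openness and
    associativity arguments can be carried out as for groupoid actions on sets. *)

Section GeneralizedElements.
Variables (G : groupoid) (X : glocale G).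
Local Notation d := (gd G).
Local Notation r := (gr G).
Local Notation u := (gu G).
Local Notation i := (gi G).
Local Notation m := (gm G).
Local Notation p := (gl_proj X).
Local Notation act := (gl_act X).

Definition gact (W : locale) (g : cmap W (G1 G)) (x : cmap W X) (H : r ∘ g = p ∘ x) :
  cmap W X := act ∘ pb_pair g x H.

Lemma gact_eq W (g g' : cmap W (G1 G)) (x x' : cmap W X) H H' :
  g = g' -> x = x' -> gact (g := g) (x := x) H = gact (g := g') (x := x') H'.
Proof. by move=> e1 e2; congr ccomp; exact: pb_pair_eq. Qed.

Lemma gact_comp V W (g : cmap W (G1 G)) (x : cmap W X) H (w : cmap V W) H' :
  gact (g := g) (x := x) H ∘ w = gact (g := g ∘ w) (x := x ∘ w) H'.
Proof. by rewrite /gact -ccompA; congr ccomp; exact: pb_pair_comp. Qed.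

Lemma gact_proj W (g : cmap W (G1 G)) (x : cmap W X) H :
  p ∘ gact (g := g) (x := x) H = d ∘ g.
Proof. by rewrite /gact ccompA gl_proj_act -ccompA pb_fst_pair. Qed.

Lemma gact_mul W (g h : cmap W (G1 G)) (x : cmap W X) H1 H2 H3 H4 :
  gact (g := gmul (g := g) (h := h) H1) (x := x) H2
  = gact (g := g) (x := gact (g := h) (x := x) H3) H4.
Proof.
have Hk : (r ∘ pb_snd) ∘ pb_pair g h H1 = p ∘ x by rewrite -ccompA pb_snd_pair H3.
have := congr1 (fun t => t ∘ pb_pair (pb_pair g h H1) x Hk) (gl_actA X).
have E1 : r ∘ (m ∘ pb_fst ∘ pb_pair (pb_pair g h H1) x Hk)
          = p ∘ (pb_snd ∘ pb_pair (pb_pair g h H1) x Hk).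
  by rewrite -(ccompA m) pb_fst_pair pb_snd_pair -H2.
have E3 : r ∘ (pb_snd ∘ pb_fst ∘ pb_pair (pb_pair g h H1) x Hk)
          = p ∘ (pb_snd ∘ pb_pair (pb_pair g h H1) x Hk).
  by rewrite -(ccompA pb_snd) pb_fst_pair !pb_snd_pair.
have eI : action_inner d act ∘ pb_pair (pb_pair g h H1) x Hk = gact H3.
  rewrite /action_inner -ccompA (pb_pair_comp _ E3); congr ccomp; apply: pb_pair_eq.
    by rewrite -(ccompA pb_snd) pb_fst_pair pb_snd_pair.
  by rewrite pb_snd_pair.
have E2 : r ∘ (pb_fst ∘ pb_fst ∘ pb_pair (pb_pair g h H1) x Hk)
          = p ∘ (action_inner d act ∘ pb_pair (pb_pair g h H1) x Hk).
  by rewrite eI -(ccompA pb_fst) !pb_fst_pair.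
rewrite -!ccompA (pb_pair_comp _ E1) (pb_pair_comp _ E2) => e.
etransitivity; last (etransitivity; first exact: e); congr ccomp; apply: pb_pair_eq.
- by rewrite -(ccompA m) pb_fst_pair.
- by rewrite pb_snd_pair.
- by rewrite -(ccompA pb_fst) !pb_fst_pair.
- exact: eI.
Qed.

Lemma gact_unit W (g : cmap W (G1 G)) (x : cmap W X) H :
  g = u ∘ p ∘ x -> gact (g := g) (x := x) H = x.
Proof.
move=> e; subst g; have := congr1 (fun t => t ∘ x) (gl_act1 X).
rewrite /action_unit -ccompA.
have E : r ∘ (u ∘ p ∘ x) = p ∘ (cid_map X ∘ x).
  by rewrite ccomp_idl !ccompA gru ccomp_idl.
rewrite (pb_pair_comp _ E) => e; rewrite -[RHS]ccomp_idl -e.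
by congr ccomp; apply: pb_pair_eq; rewrite ?ccomp_idl.
Qed.

Lemma gactK W (g : cmap W (G1 G)) (x : cmap W X) H K :
  gact (g := i ∘ g) (x := gact (g := g) (x := x) H) K = x.
Proof.
have E1 : r ∘ (i ∘ g) = d ∘ g by rewrite ri.
have E2 : r ∘ gmul E1 = p ∘ x by rewrite gmul_r.
by rewrite -(gact_mul (H1 := E1) E2) gact_unit // gmulVl // -ccompA H ccompA.
Qed.

Lemma gactVK W (g : cmap W (G1 G)) (x : cmap W X) H K :
  gact (g := g) (x := gact (g := i ∘ g) (x := x) H) K = x.
Proof.
have E1 : r ∘ g = d ∘ (i ∘ g) by rewrite di.
have E2 : r ∘ gmul E1 = p ∘ x by rewrite gmul_r.
rewrite -(gact_mul (H1 := E1) E2) gact_unit // gmulV // -ccompA -ri H; exact: ccompA.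
Qed.

Lemma gact_id : gact pb_comm = act.
Proof. by rewrite /gact pb_pair_id ccomp_idr. Qed.

(** [act] is, up to the isomorphism [(g, x) |-> (g, g x)], the second projection of the
    pullback of [d] and [p], and [d] is open. *)
Lemma gl_act_open : etale G -> is_open act.
Proof.
move=> etG; pose P := pullback d p.
have H : d ∘ pb_fst = p ∘ act by rewrite gl_proj_act.
pose al : cmap (pullback r p) P := pb_pair pb_fst act H.
have K : r ∘ (i ∘ pb_fst) = p ∘ (pb_snd : cmap P X) by rewrite ri pb_comm.
have K' : r ∘ (pb_fst : cmap P (G1 G)) = p ∘ gact K by rewrite gact_proj di.
pose be : cmap P (pullback r p) := pb_pair pb_fst (gact K) K'.
have actE : act = pb_snd ∘ al by rewrite pb_snd_pair.
rewrite {1}actE; apply: is_open_comp.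
  exact: is_open_pb_snd (local_homeo_open etG).
apply: is_open_iso; exists be; split.
  apply: pb_jointly_monic; rewrite ccompA ?pb_fst_pair ?pb_snd_pair ccomp_idr //.
  have E : r ∘ ((i ∘ pb_fst) ∘ al) = p ∘ (pb_snd ∘ al).
    by rewrite -(ccompA i) ri /al pb_fst_pair pb_snd_pair.
  rewrite (gact_comp _ E).
  have E' : r ∘ (i ∘ pb_fst) = p ∘ gact pb_comm by rewrite ri gact_proj.
  have e1 : i ∘ pb_fst ∘ al = i ∘ pb_fst by rewrite -ccompA pb_fst_pair.
  have e2 : pb_snd ∘ al = gact pb_comm by rewrite pb_snd_pair gact_id.
  by rewrite (gact_eq E E' e1 e2) gactK.
apply: pb_jointly_monic; rewrite ccompA ?pb_fst_pair ?pb_snd_pair ccomp_idr //.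
exact: gactVK.
Qed.

End GeneralizedElements.

(** Arrows act on themselves by multiplication, so that facts about actions
    specialize to the quantale of the groupoid. *)
Definition arrow_glocale (G : groupoid) : glocale G :=
  GLocale (gmA G) (gm1l G).

(** * The module of a groupoid action *)

Section ActionModule.
Variables (G : groupoid) (etG : etale G) (X : glocale G).
Local Notation d := (gd G).
Local Notation r := (gr G).
Local Notation u := (gu G).
Local Notation i := (gi G).
Local Notation m := (gm G).
Local Notation p := (gl_proj X).
Local Notation act := (gl_act X).
Local Notation Q := (groupoid_quantale etG).
Implicit Types (a b : G1 G) (x t : X) (v : G0 G).

Definition act_open a x : X :=
  direct_image act ((pb_fst : cmap (pullback r p) _)^* a ⊓ pb_snd^* x).

Lemma act_open_le a x t : act_open a x ⊑ t <-> opn (act^* t) a x.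
Proof. by rewrite -pb_le; exact: (direct_image_adj (gl_act_open X etG)). Qed.

Lemma act_open_supl x : preserves_sup (fun a => act_open a x).
Proof.
move=> S; rewrite /act_open inv_image_sup preserves_sup_meetl image_comp.
by rewrite (left_adjoint_sup (direct_image_adj (gl_act_open X etG))) image_comp.
Qed.

Lemma act_open_supr a : preserves_sup (act_open a).
Proof.
move=> S; rewrite /act_open inv_image_sup meet_sup image_comp.
by rewrite (left_adjoint_sup (direct_image_adj (gl_act_open X etG))) image_comp.
Qed.

Lemma act_open_mono a b x t : a ⊑ b -> x ⊑ t -> act_open a x ⊑ act_open b t.
Proof.
move=> ab xt; apply: (@sle_trans _ _ (act_open b x)).
  exact: (preserves_sup_mono (act_open_supl x)).
exact: (preserves_sup_mono (act_open_supr b)).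
Qed.

(** Both ways of acting with [a] and [b] on [x] are characterized by their effect on
    generalized elements, by Beck-Chevalley along the multiplication here and along
    the action in [act_open_actP]; associativity is then that of the action. *)
Lemma act_open_mulP a b x t : act_open (gq_mul a b) x ⊑ t <->
  forall (W : locale) (g h : cmap W (G1 G)) (y : cmap W X) (gh : r ∘ g = d ∘ h) K,
    g^* a ⊓ h^* b ⊓ y^* x ⊑ (gact (g := gmul gh) (x := y) K)^* t.
Proof.
pose G2X := pullback (r ∘ m) p.
have H0 : r ∘ (m ∘ pb_fst) = p ∘ (pb_snd : cmap G2X X) by rewrite ccompA pb_comm.
rewrite act_open_le -(pb_open_left H0 _ _ _ (gm_open etG)) -pb_le.
split=> [h0 W g h y gh K|h].
  have K0 : (r ∘ m) ∘ pb_pair g h gh = p ∘ y by rewrite -K -ccompA.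
  have := inv_image_mono (pb_pair (pb_pair g h gh) y K0) h0.
  rewrite !inv_image_meet.
  have e1 : pb_fst ∘ pb_pair (pb_pair g h gh) y K0 = pb_pair g h gh by exact: pb_fst_pair.
  have e2 : pb_snd ∘ pb_pair (pb_pair g h gh) y K0 = y by exact: pb_snd_pair.
  have -> : gact K = act ∘ pb_pair (m ∘ pb_fst) pb_snd H0
      ∘ pb_pair (pb_pair g h gh) y K0.
    rewrite -ccompA; congr ccomp; apply: pb_jointly_monic.
      by rewrite pb_fst_pair ccompA pb_fst_pair -ccompA e1.
    by rewrite pb_snd_pair ccompA pb_snd_pair e2.
  have -> : g^* a = (pb_fst ∘ (pb_fst ∘ pb_pair (pb_pair g h gh) y K0))^* a.
    by rewrite e1 pb_fst_pair.
  have -> : h^* b = (pb_snd ∘ (pb_fst ∘ pb_pair (pb_pair g h gh) y K0))^* b.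
    by rewrite e1 pb_snd_pair.
  by have -> : y^* x = (pb_snd ∘ pb_pair (pb_pair g h gh) y K0)^* x by rewrite e2.
have gh : r ∘ (pb_fst ∘ (pb_fst : cmap G2X _)) = d ∘ (pb_snd ∘ pb_fst).
  by rewrite !ccompA pb_comm.
have eg : gmul gh = m ∘ pb_fst.
  by rewrite -(gmul_comp pb_comm gh) /gmul pb_pair_id ccomp_idr.
have K : r ∘ gmul gh = p ∘ (pb_snd : cmap G2X _) by rewrite eg.
have {h}: pb_fst^* (pb_fst^* a) ⊓ pb_fst^* (pb_snd^* b) ⊓ pb_snd^* x ⊑ (gact K)^* t.
  exact: (h _ _ _ _ gh K).
by rewrite (gact_eq K H0 eg erefl) -inv_image_meet.
Qed.

Lemma act_open_actP a b x t : act_open a (act_open b x) ⊑ t <->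
  forall (W : locale) (g h : cmap W (G1 G)) (y : cmap W X) (hy : r ∘ h = p ∘ y) K,
    g^* a ⊓ (h^* b ⊓ y^* x) ⊑ (gact (g := g) (x := gact hy) K)^* t.
Proof.
pose GGX := pullback r (p ∘ act).
have H0 : r ∘ (pb_fst : cmap GGX (G1 G)) = p ∘ (act ∘ pb_snd) by rewrite ccompA pb_comm.
rewrite act_open_le -(pb_open_right H0 _ _ _ (gl_act_open X etG)) -pb_le.
split=> [h0 W g h y hy K|h].
  have K0 : r ∘ g = (p ∘ act) ∘ pb_pair h y hy by rewrite K -ccompA.
  have := inv_image_mono (pb_pair g (pb_pair h y hy) K0) h0.
  rewrite !inv_image_meet.
  have e1 : pb_fst ∘ pb_pair g (pb_pair h y hy) K0 = g by exact: pb_fst_pair.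
  have e2 : pb_snd ∘ pb_pair g (pb_pair h y hy) K0 = pb_pair h y hy by exact: pb_snd_pair.
  have -> : gact K = act ∘ pb_pair pb_fst (act ∘ pb_snd) H0
      ∘ pb_pair g (pb_pair h y hy) K0.
    rewrite -ccompA; congr ccomp; apply: pb_jointly_monic.
      by rewrite pb_fst_pair ccompA pb_fst_pair e1.
    by rewrite pb_snd_pair ccompA pb_snd_pair -ccompA e2.
  have -> : h^* b = (pb_fst ∘ (pb_snd ∘ pb_pair g (pb_pair h y hy) K0))^* b.
    by rewrite e2 pb_fst_pair.
  have -> : y^* x = (pb_snd ∘ (pb_snd ∘ pb_pair g (pb_pair h y hy) K0))^* x.
    by rewrite e2 pb_snd_pair.
  by have -> : g^* a = (pb_fst ∘ pb_pair g (pb_pair h y hy) K0)^* a by rewrite e1.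
have hy : r ∘ (pb_fst ∘ (pb_snd : cmap GGX _)) = p ∘ (pb_snd ∘ pb_snd).
  by rewrite !ccompA pb_comm.
have eg : gact hy = act ∘ pb_snd by rewrite -(gact_comp pb_comm hy) gact_id.
have K : r ∘ (pb_fst : cmap GGX _) = p ∘ gact hy by rewrite eg.
have {h}: pb_fst^* a ⊓ (pb_snd^* (pb_fst^* b) ⊓ pb_snd^* (pb_snd^* x)) ⊑ (gact K)^* t.
  exact: (h _ _ _ _ hy K).
by rewrite (gact_eq K H0 erefl eg) -inv_image_meet.
Qed.

Lemma act_openA a b x : act_open (gq_mul a b) x = act_open a (act_open b x).
Proof.
apply: eq_sle => t; rewrite act_open_mulP act_open_actP; split=> H W g h y.
- move=> hy K; have gh : r ∘ g = d ∘ h by rewrite K gact_proj.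
  have K' : r ∘ gmul gh = p ∘ y by rewrite gmul_r.
  by rewrite -(gact_mul (H1 := gh) K') meetA; exact: H.
- move=> gh K; have hy : r ∘ h = p ∘ y by rewrite -K gmul_r.
  have K' : r ∘ g = p ∘ gact hy by rewrite gact_proj.
  by rewrite (gact_mul (H3 := hy) _ K') -meetA; exact: H.
Qed.

(** Unit arrows act trivially, so the action restricted to them only cuts down to
    [p^* v]; the formal content is Beck-Chevalley along the open map [u]. *)
Lemma act_open_base v x : act_open (direct_image u v) x = p^* v ⊓ x.
Proof.
have H : r ∘ (u ∘ pb_fst) = p ∘ (pb_snd : cmap (pullback (r ∘ u) p) X).
  by rewrite ccompA pb_comm.
have e : act ∘ pb_pair (u ∘ pb_fst) pb_snd H = pb_snd.
  rewrite -/(gact H) gact_unit // -ccompA -[LHS]/(u ∘ pb_fst); congr ccomp.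
  by rewrite -pb_comm gru ccomp_idl.
apply: eq_sle => t; rewrite act_open_le -(pb_open_left H) -?pb_le; last exact: gu_open.
have -> : (pb_pair (u ∘ pb_fst) pb_snd H)^* (act^* t)
  = (act ∘ pb_pair (u ∘ pb_fst) pb_snd H)^* t by [].
rewrite e; split=> [h|h].
  have K : (r ∘ u) ∘ p = p ∘ cid_map X by rewrite gru ccomp_idl ccomp_idr.
  have := inv_image_mono (pb_pair p (cid_map X) K) h; rewrite inv_image_meet.
  have sE (z : X) : (pb_pair p (cid_map X) K)^* (pb_snd^* z) = z.
    have eK := pb_snd_pair K; exact (congr1 (fun w : cmap X X => w^* z) eK).
  have fE (z : G0 G) : (pb_pair p (cid_map X) K)^* (pb_fst^* z) = p^* z.
    have eK := pb_fst_pair K; exact (congr1 (fun w : cmap X (G0 G) => w^* z) eK).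
  by rewrite !sE fE.
apply: sle_trans (inv_image_mono _ h); rewrite inv_image_meet.
apply: meet_mono; last exact: sle_refl.
have -> : (pb_fst : cmap (pullback (r ∘ u) p) _)^* v = ((r ∘ u) ∘ pb_fst)^* v.
  by rewrite gru ccomp_idl.
by rewrite pb_comm; exact: sle_refl.
Qed.

End ActionModule.

(** * The quantale of an étale groupoid *)

Section GroupoidInverse.
Variables (G : groupoid) (etG : etale G).
Local Notation d := (gd G).
Local Notation r := (gr G).
Local Notation u := (gu G).
Local Notation i := (gi G).
Local Notation m := (gm G).
Local Notation Q := (groupoid_quantale etG).
Implicit Types (a b s : G1 G) (v w : G0 G).

Lemma gact_le (X : glocale G) W (g : cmap W (G1 G)) (y : cmap W X) H a x :
  g^* a ⊓ y^* x ⊑ (gact (g := g) (x := y) H)^* (act_open a x).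
Proof.
have /(act_open_le etG)/pb_le/(inv_image_mono (pb_pair g y H)) := sle_refl (act_open a x).
rewrite inv_image_meet.
have -> : g^* a = (pb_fst ∘ pb_pair g y H)^* a by rewrite pb_fst_pair.
by have -> : y^* x = (pb_snd ∘ pb_pair g y H)^* x by rewrite pb_snd_pair.
Qed.

Lemma gmul_le W (g h : cmap W (G1 G)) H a b :
  g^* a ⊓ h^* b ⊑ (gmul (g := g) (h := h) H)^* (gq_mul a b).
Proof. exact: (@gact_le (arrow_glocale G)). Qed.

Lemma gu_adj : left_adjoint (direct_image u) u.
Proof. exact: direct_image_adj (gu_open etG). Qed.

Lemma gu_direct_mono v w : v ⊑ w -> direct_image u v ⊑ direct_image u w.
Proof. exact: (preserves_sup_mono (left_adjoint_sup gu_adj)). Qed.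

Lemma gu_direct_base v : direct_image u v ⊑ gq_one G.
Proof. exact: gu_direct_mono (top_max v). Qed.

(** [u] has the left inverse [d], hence [u_!] is injective and identifies the opens of
    [G0] with the elements of [B] (see [gu_baseK]). *)
Lemma gu_directK v : u^* (direct_image u v) = v.
Proof.
apply: sle_anti; last by apply/gu_adj; exact: sle_refl.
have duE w : u^* (d^* w) = w := congr1 (fun t => t^* w) (gdu G).
rewrite -[X in _ ⊑ X]duE; apply: inv_image_mono; apply/gu_adj.
by rewrite duE; exact: sle_refl.
Qed.

Lemma gu_baseK b : b ⊑ gq_one G -> direct_image u (u^* b) = b.
Proof.
move=> be; rewrite -[u^* b]meetTl (direct_image_frob (gu_open etG)) meetC.
exact: meet_idPl.
Qed.

Lemma gu_direct_meet v w :
  direct_image u (v ⊓ w) = direct_image u v ⊓ direct_image u w.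
Proof. by rewrite -(direct_image_frob (gu_open etG)) gu_directK. Qed.

Lemma gq_mul_base v a : gq_mul (direct_image u v) a = d^* v ⊓ a.
Proof. exact: (@act_open_base G etG (arrow_glocale G)). Qed.

(** The groupoid law [g = g g^-1 g], read at the generic arrow. *)
Lemma gq_gelfand a : a ⊑ gq_mul (gq_mul a (gq_inv a)) a.
Proof.
have H1 : r ∘ cid_map (G1 G) = d ∘ i by rewrite ccomp_idr gdi.
have H2 : r ∘ gmul H1 = d ∘ cid_map (G1 G) by rewrite gmul_r gri ccomp_idr.
have e : gmul H2 = cid_map _.
  by apply: gmul1l; rewrite gmulV ?ccomp_idr.
have := gmul_le H2 (gq_mul a (gq_inv a)) a; rewrite e; apply: sle_trans.
apply: meet_glb; last exact: sle_refl.
apply: sle_trans (gmul_le H1 a (gq_inv a)); apply: meet_glb; first exact: sle_refl.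
rewrite gq_invE; apply: sle_eq; exact: esym (congr1 (fun t => t^* a) (giK G)).
Qed.

(** The elements of [s^* s] are the [g^-1 h] with [g, h] in [s] and [d g = d h].  Since
    the opens below [s] are cut out by [d], such [g] and [h] coincide, and [g^-1 h] is
    a unit.  The generic such pair lives on an open sublocale of [G2]. *)
Lemma gd_section_inj s : (forall a, a ⊑ s -> exists w, a = s ⊓ d^* w) ->
  gq_mul (gq_inv s) s ⊑ gq_one G.
Proof.
move=> hs; apply/(gq_mul_le etG)/pb_le; apply: open_incl_topP.
set t := _ ⊓ _; set k := open_incl t.
have k1 : (i ∘ pb_fst ∘ k)^* s = ⊤.
  apply: top_eq; rewrite -(open_incl_top t); apply: inv_image_mono.
  by rewrite /t gq_invE; exact: meetl.
have k2 : (pb_snd ∘ k)^* s = ⊤.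
  by apply: top_eq; rewrite -(open_incl_top t); apply: inv_image_mono; exact: meetr.
have dE : d ∘ (i ∘ pb_fst ∘ k) = d ∘ (pb_snd ∘ k).
  by rewrite !ccompA gdi -pb_comm.
have gE : i ∘ pb_fst ∘ k = pb_snd ∘ k.
  apply: cmap_eq => a; have [w e] := hs _ (meetl s a).
  rewrite -[LHS]meetTl -k1 -[RHS]meetTl -k2 -!inv_image_meet e !inv_image_meet k1 k2.
  by rewrite !meetTl; exact: (congr1 (fun t => t^* w) dE).
have H : r ∘ (pb_fst ∘ k) = d ∘ (pb_snd ∘ k) by rewrite !ccompA pb_comm.
have mE : m ∘ k = u ∘ r ∘ (pb_snd ∘ k).
  rewrite -[RHS](gmulVl H); last by rewrite -gE !ccompA giK ccomp_idl.
  by rewrite -(gmul_comp pb_comm H) /gmul pb_pair_id ccomp_idr.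
have -> : k^* (m^* (gq_one G)) = (u ∘ r ∘ (pb_snd ∘ k))^* (gq_one G).
  exact: (congr1 (fun t => t^* (gq_one G)) mE).
have -> : (u ∘ r ∘ (pb_snd ∘ k))^* (gq_one G)
  = (r ∘ (pb_snd ∘ k))^* (u^* (gq_one G)) by [].
by rewrite gu_directK inv_image_top.
Qed.

(** If [d] is injective on [s] and on [s'], then [d] and [r] are both injective on
    [s ⊓ i^* s'], and such meets cover [G1]. *)
Lemma groupoid_quantale_inverse : inverse_quantale Q.
Proof.
split; first exact: gq_gelfand.
apply: (@cover_join_dense (G1 G)) => [s t|]; first exact: (@partial_unit_down Q).
have [S [Stop hS]] := local_homeoP etG.
have iStop : ⨆ (i^* @` S) = ⊤ by rewrite -inv_image_sup Stop inv_image_top.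
have inj s : S s -> gq_mul (gq_inv s) s ⊑ gq_one G.
  by move=> /hS [v [hs _]]; apply: gd_section_inj => a /hs [w _ e]; exists w.
apply: top_eq; apply: (cover_le Stop) => s Ss.
apply: (cover_le iStop) => _ [s' Ss' <-].
apply: sup_ub; split.
  apply: sle_trans (inj _ Ss).
  have le_s : i^* s' ⊓ (s ⊓ ⊤) ⊑ s by apply: (sle_trans (meetr _ _)); exact: meetl.
  by apply: (@qmul_mono Q) => //; exact: (@qinv_mono Q).
(* The other product is governed by [s'], as [i] exchanges [d] and [r]. *)
apply: sle_trans (inj _ Ss').
have le_s : i^* s' ⊓ (s ⊓ ⊤) ⊑ gq_inv s' by rewrite gq_invE; exact: meetl.
apply: (@qmul_mono Q) => //; rewrite -{2}(gq_invK s'); exact: (@qinv_mono Q).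
Qed.

(** Obtained from [gq_mul_base] by applying the involution, which fixes [B]. *)
Lemma gq_mul_baser v a : gq_mul a (direct_image u v) = a ⊓ r^* v.
Proof.
have e : gq_inv (direct_image u v) = direct_image u v.
  exact: (qinv_base_id groupoid_quantale_inverse (gu_direct_base v)).
rewrite -[LHS]gq_invK (gq_invM etG) e gq_mul_base !gq_invE inv_image_meet meetC; congr meet.
  exact: (congr1 (fun t => t^* a) (giK G)).
exact: (congr1 (fun t => t^* v) (gdi G)).
Qed.

End GroupoidInverse.

(** * From groupoid sheaves to quantale sheaves *)

Section SheafToModule.
Variables (G : groupoid) (etG : etale G).
Local Notation d := (gd G).
Local Notation r := (gr G).
Local Notation u := (gu G).
Local Notation Q := (groupoid_quantale etG).

Section Locale.
Variable X : glocale G.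
Local Notation p := (gl_proj X).

Lemma act_open1 (x : X) : act_open (gq_one G) x = x.
Proof. by rewrite (act_open_base etG) inv_image_top meetTl. Qed.

Definition act_module : qmodule Q X :=
  @QModule Q X (@act_open G X) (@act_openA G etG X) act_open1
    (@act_open_supl G etG X) (@act_open_supr G etG X).

Lemma act_module_base (b : Q) (x : X) : b ⊑ qone Q ->
  act_module b x = act_module b ⊤ ⊓ x.
Proof.
by move=> be; rewrite /= -(gu_baseK etG be) !(act_open_base etG) meetT.
Qed.

Definition glocale_qlocale : qlocale Q := QLocale act_module_base.

End Locale.

Section Sheaf.
Variable X : gsheaf G.
Local Notation p := (gl_proj X).

Let pO : is_open p := local_homeo_open (gs_local_homeo X).

Definition sheaf_support (x : X) : G1 G := direct_image u (direct_image p x).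

Lemma sheaf_supportP : is_support (X := glocale_qlocale X) sheaf_support.
Proof.
split.
- by move=> x; exact: gu_direct_base.
- apply: (@preserves_sup_comp X (G0 G) (G1 G)).
    exact: left_adjoint_sup (gu_adj etG).
  exact: left_adjoint_sup (direct_image_adj pO).
- move=> b x be; rewrite /= -(gu_baseK etG be) (act_open_base etG) (gq_mul_base etG).
  rewrite /sheaf_support meetC (direct_image_frob pO) [RHS]meetC.
  rewrite -(direct_image_frob (gu_open etG)); congr direct_image; congr meet.
  exact: esym (congr1 (fun t => t^* (u^* b)) (gdu G)).
- move=> x; rewrite /= (act_open_base etG) meetC; apply: meet_idPl.
  by apply/(direct_image_adj pO); exact: sle_refl.
Qed.

Lemma sheaf_ql_open : ql_open (glocale_qlocale X).
Proof. by exists sheaf_support; exact: sheaf_supportP. Qed.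

(** The opens on which [p] restricts to an isomorphism onto an open of [G0] are local
    sections: there [x = s ⊓ p^* (p_! x)]. *)
Lemma sheaf_cover : ⨆ (local_section sheaf_ql_open) = ⊤.
Proof.
have [S [Stop hS]] := local_homeoP (gs_local_homeo X).
apply: top_eq; rewrite -Stop; apply: sup_lub => s /hS [v [hs _]].
apply: (@sup_ub X) => x /hs [w _ ->].
rewrite (support_unique (supportP sheaf_ql_open) sheaf_supportP) /=.
rewrite (act_open_base etG) (direct_image_frob pO) inv_image_meet.
rewrite [RHS]meetC meetA; congr meet; apply/esym/meet_idPl.
by apply/(direct_image_adj pO); exact: sle_refl.
Qed.

Definition gsheaf_qsheaf : qsheaf Q := QSheaf sheaf_cover.

End Sheaf.
End SheafToModule.

Section PartialUnitOpens.
Variables (G : groupoid) (etG : etale G).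
Local Notation r := (gr G).
Local Notation u := (gu G).
Local Notation Q := (groupoid_quantale etG).
Local Notation invQ := (groupoid_quantale_inverse etG).
Variables (Y : locale) (f : cmap Y (G0 G)).

Lemma pullback_le_partial_unit (I J : pullback r f) :
  (forall s y, partial_unit (Q := Q) s -> opn I s y -> opn J s y) -> I ⊑ J.
Proof.
move=> h a y Iay; rewrite -/(opn J a y).
have -> : a = ⨆ [set s : G1 G | partial_unit (Q := Q) s /\ s ⊑ a].
  exact: (partial_unit_dense invQ).
apply: (pbi_supl (opnP J)) => s [hs sa].
by apply: h => //; apply: (pbi_down (opnP I) Iay sa); exact: sle_refl.
Qed.

(** Since [s = s (s^* s)] and opens of the pullback are balanced over [G0], membership
    of [(s, x)] only depends on the part of [x] over the domain of [s^* s]. *)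
Lemma opn_partial_unit (I : pullback r f) s x y : partial_unit (Q := Q) s ->
  f^* (u^* (gq_mul (gq_inv s) s)) ⊓ x ⊑ y -> opn I s y -> opn I s x.
Proof.
move=> hs le_y Isy; have [s1 s2] := hs.
have sc : s = s ⊓ r^* (u^* (gq_mul (gq_inv s) s)).
  rewrite -(gq_mul_baser etG) gu_baseK //.
  exact: esym (etrans (qmulA _ _ _) (partial_unitK invQ hs)).
rewrite sc; apply/(pbi_bal (opnP I)).
by apply: (pbi_down (opnP I) Isy) => //; exact: sle_refl.
Qed.

End PartialUnitOpens.

(** * From quantale sheaves to groupoid sheaves *)

Section ModuleToSheaf.
Variables (G : groupoid) (etG : etale G).
Local Notation d := (gd G).
Local Notation r := (gr G).
Local Notation u := (gu G).
Local Notation m := (gm G).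
Local Notation Q := (groupoid_quantale etG).
Local Notation invQ := (groupoid_quantale_inverse etG).
Variable X : qsheaf Q.
Local Notation supp := (support (qs_open X)).
Local Notation suppP := (supportP (qs_open X)).
Local Notation "a • x" := (@qact Q X (ql_mod X) a x) (at level 40, left associativity).
Implicit Types (a b q s : G1 G) (x y t : X) (v w z : G0 G).

Let qactl x : preserves_sup (L := G1 G) (fun a => a • x).
Proof. exact (qact_supl (ql_mod X) x). Qed.

Let qactr a : preserves_sup (fun x => a • x).
Proof. exact (qact_supr (ql_mod X) a). Qed.

Definition qproj_inv v : X := direct_image u v • ⊤.

Lemma qact_gu v x : direct_image u v • x = qproj_inv v ⊓ x.
Proof. by apply: ql_base; exact: gu_direct_base. Qed.

Lemma qproj_inv_sup : preserves_sup qproj_inv.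
Proof.
apply: (@preserves_sup_comp (G0 G) (G1 G) X (fun a => a • ⊤)); first exact: qactl.
exact: left_adjoint_sup (gu_adj etG).
Qed.

Lemma qproj_inv_meet v w : qproj_inv (v ⊓ w) = qproj_inv v ⊓ qproj_inv w.
Proof.
rewrite -qact_gu {2}/qproj_inv qact_mulE /qproj_inv gu_direct_meet //.
by rewrite (qmul_base invQ) //; exact: gu_direct_base.
Qed.

Lemma qproj_inv_top : qproj_inv ⊤ = ⊤.
Proof. exact: (qact1 (ql_mod X)). Qed.

Definition qproj : cmap X (G0 G) := CMap qproj_inv_sup qproj_inv_meet qproj_inv_top.

Lemma qact_balance a z x : (a ⊓ r^* z) • x = a • (qproj^* z ⊓ x).
Proof. by rewrite -(gq_mul_baser etG) -qact_gu qactA. Qed.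

Lemma qact_ideal t : pb_ideal r qproj (fun a x => a • x ⊑ t).
Proof.
split.
- by move=> a x a' x' h aa xx; apply: sle_trans h; exact (@qact_mono Q X _ _ _ _ aa xx).
- move=> S x h; rewrite qactl.
  by apply: sup_lub => _ [a Sa <-]; exact: h.
- move=> a S h; rewrite qactr.
  by apply: sup_lub => _ [x Sx <-]; exact: h.
- by move=> a x z; rewrite qact_balance.
Qed.

(** The right adjoint of the module action. *)
Definition qgact_inv t : pullback r qproj := exist _ _ (qact_ideal t).

Lemma opn_qgact t a x : opn (qgact_inv t) a x = (a • x ⊑ t).
Proof. by []. Qed.

Lemma opn_qact_partial_unit (I : pullback r qproj) s x y : partial_unit (Q := Q) s ->
  gq_inv s • (s • x) ⊑ y -> opn I s y -> opn I s x.
Proof.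
move=> hs le_y; apply: (opn_partial_unit hs); apply: sle_trans le_y.
by rewrite qact_mulE -[qproj^* _ ⊓ x]qact_gu (gu_baseK etG); [exact: sle_refl|case: hs].
Qed.

(** If [s x ⊑ ⨆ S], then [s^* s x ⊑ ⨆ (s^* t)] over the [t] in [S], and each [(s, s^* t)]
    lies in the set of pairs of [t], because [s s^* t ⊑ t]. *)
Lemma qgact_inv_sup : preserves_sup qgact_inv.
Proof.
move=> S; apply: sle_anti; last first.
  apply: sup_lub => _ [t St <-] a x; rewrite -!/(opn _ _ _) !opn_qgact => h.
  by apply: (sle_trans h); exact: sup_ub.
apply: (@pullback_le_partial_unit G etG X qproj
  (qgact_inv (⨆ S)) (⨆ (qgact_inv @` S))) => s x hs; rewrite opn_qgact => h.
apply: (opn_qact_partial_unit hs (qact_monor (X := X) _ h)).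
rewrite qactr; apply: (pbi_supr (opnP _)) => _ [t St <-].
have : qgact_inv t ⊑ ⨆ (qgact_inv @` S) by apply: sup_ub; exists t.
by apply; exact: (partial_unit_Kinv (X := X) t hs).
Qed.

Lemma qgact_inv_meet t t' : qgact_inv (t ⊓ t') = qgact_inv t ⊓ qgact_inv t'.
Proof.
apply: sle_anti => a x.
  move=> h; apply/opn_meet; split; apply: (sle_trans h); [exact: meetl|exact: meetr].
by move=> /opn_meet [h h']; exact: (meet_glb h h').
Qed.

Lemma qgact_inv_top : qgact_inv ⊤ = ⊤.
Proof. by apply: top_eq => a x _; exact: (top_max (a • x)). Qed.

Definition qgact : cmap (pullback r qproj) X :=
  CMap qgact_inv_sup qgact_inv_meet qgact_inv_top.

Lemma qgact_le t a x : opn (qgact^* t) a x <-> a • x ⊑ t.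
Proof. by []. Qed.

(** One inclusion is [u_!(v) · ⊤ · ⊤ ⊑ u_!(v) · ⊤].  For the other, a pair [(s, x)] with
    [s x ⊑ b ⊤], where [b = u_!(v)], is dominated by [(s, s^* b ⊤)].  With
    [c = s^* b s] in [B] one has [s^* b = c s^*], so [s^* b ⊤ ⊑ c ⊤], and balancing
    trades [(s, c ⊤)] for [(s c, ⊤)], where [s c ⊑ b s ⊑ d^* v]. *)
Lemma qproj_act : qproj ∘ qgact = d ∘ pb_fst.
Proof.
apply: cmap_eq => v; apply: sle_anti; last first.
  apply/tensor_le; apply/qgact_le; rewrite -[d^* v]meetT -(gq_mul_base etG) qactA.
  by apply: (@qact_monor Q X); exact: top_max.
apply: (@pullback_le_partial_unit G etG X qproj
  (qgact_inv (qproj_inv v)) (pb_fst^* (d^* v))) => s x hs; rewrite opn_qgact => h.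
have [s1 s2] := hs.
apply: (opn_qact_partial_unit hs (@qact_monor Q X _ _ _ h)).
pose b := direct_image u v.
pose c := gq_mul (gq_inv s) (gq_mul b s).
have ce : c ⊑ gq_one G.
  apply: sle_trans s1; apply: (@qmul_mono Q); first exact: sle_refl.
  exact: (@qmul_basel Q _ _ (gu_direct_base etG v)).
have cE : direct_image u (u^* c) = c by exact: gu_baseK.
have sc : gq_mul s c ⊑ d^* v.
  apply: (@sle_trans _ _ (gq_mul b s)); last by rewrite /b (gq_mul_base etG); exact: meetl.
  by rewrite /c (gq_mulA etG); exact: (@qmul_basel Q).
have le_c : gq_inv s • qproj_inv v ⊑ qproj_inv (u^* c).
  have hs' := partial_unit_inv hs.
  rewrite /qproj_inv cE -/b qact_mulE.
  have -> : qmul (gq_inv s : Q) b = gq_mul c (gq_inv s).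
    have {1}-> : gq_inv s = gq_mul (gq_mul (gq_inv s) s) (gq_inv s).
      by rewrite -{3}(gq_invK s); exact: esym (partial_unitK invQ hs').
    rewrite /c -[LHS]/(gq_mul _ b) -!(gq_mulA etG); congr (gq_mul (gq_inv s)).
    rewrite (gq_mulA etG); apply: (qmul_baseC invQ) => //; exact: gu_direct_base.
  by rewrite -qact_mulE; apply: qact_monor; exact: top_max.
have Jsc : opn (pb_fst^* (d^* v) : pullback r qproj) (gq_mul s c) ⊤.
  apply: (pbi_down (opnP _) _ sc (sle_refl _)); apply/tensor_le; exact: sle_refl.
apply: (pbi_down (opnP _) _ (sle_refl s) le_c).
rewrite -[qproj_inv (u^* c)]meetT; apply/(pbi_bal (opnP _)).
by rewrite -(gq_mul_baser etG) cE.
Qed.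

(** Both sides are joins over triples [(a, b, y)]: one over those with [(a b) y ⊑ t],
    the other over those with [a (b y) ⊑ t]. *)
Lemma qgact_mul : action_assoc m (grm G) qgact qproj_act.
Proof.
rewrite /action_assoc /action_inner; apply: cmap_eq => t; apply: sle_anti.
  apply: pb_pair_le => a x /qgact_le ax_t.
  rewrite -[(m ∘ pb_fst)^* a]/(pb_fst^* (m^* a)) (pb_density (m^* a)).
  apply: inv_image_sup_meet_le => _ [b [c [bc ->]]].
  have {}bc : gq_mul b c ⊑ a by exact/(gq_mul_le etG).
  rewrite inv_image_meet -meetA.
  apply: (@sle_trans _ _ ((pb_fst ∘ pb_fst)^* b ⊓
    (qgact ∘ pb_pair (pb_snd ∘ pb_fst) pb_snd
      (action_compat_inner (gd G) (gr G) qproj))^* (c • x))).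
    apply: meet_mono; first exact: sle_refl.
    exact: (pb_pair_ge (action_compat_inner (gd G) (gr G) qproj)
      (I := qgact_inv (c • x)) (sle_refl (c • x))).
  apply: (pb_pair_ge (action_compat_outer qproj_act) (I := qgact_inv t)).
  rewrite opn_qgact; apply: sle_trans ax_t.
  by rewrite qact_mulE; apply: (@qact_mono Q X) => //; exact: sle_refl.
apply: pb_pair_le => a x /qgact_le ax_t.
apply: pb_pair_meetr_le => b y /qgact_le by_x.
rewrite meetA.
apply: (@sle_trans _ _ ((m ∘ pb_fst)^* (gq_mul a b) ⊓ pb_snd^* y)).
  apply: meet_mono; last exact: sle_refl.
  have : (pb_fst : cmap (pullback r d) _)^* a ⊓ pb_snd^* b ⊑ m^* (gq_mul a b).
    by apply/pb_le/(gq_mul_le etG); exact: sle_refl.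
  by move=> /(inv_image_mono (pb_fst : cmap (pullback (r ∘ pb_snd) qproj) _));
    rewrite inv_image_meet.
apply: (pb_pair_ge (action_compat_mul (grm G) qproj) (I := qgact_inv t)).
rewrite opn_qgact; apply: sle_trans ax_t.
by rewrite -[gq_mul a b]/(qmul (a : Q) b) qactA; exact: (@qact_monor Q X).
Qed.

Lemma qgact_unit : action_unit u (gru G) qproj qgact.
Proof.
apply: cmap_eq => t; apply: sle_anti.
  apply: pb_pair_le => a x /qgact_le; apply: sle_trans.
  rewrite -[(u ∘ qproj)^* a]/(qproj_inv (u^* a)) -qact_gu.
  apply: (@qact_mono Q X); last exact: sle_refl.
  by apply/(gu_adj etG); exact: sle_refl.
apply: (@sle_trans _ _ ((u ∘ qproj)^* (gq_one G) ⊓ (cid_map X)^* t)).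
  apply: meet_glb; last exact: sle_refl.
  have -> : (u ∘ qproj)^* (gq_one G) = qproj^* (u^* (gq_one G)) by [].
  by rewrite (gu_directK etG) inv_image_top; exact: top_max.
by apply: pb_pair_ge; apply/qgact_le; apply: sle_eq; exact: (qact1 (ql_mod X)).
Qed.

Definition qsheaf_glocale : glocale G := GLocale qgact_mul qgact_unit.

(** The local sections of the module cover, and on a local section [s] the support
    gives the inverse [x |-> u^* (ς(x))] of [w |-> s ⊓ p^* w]. *)
Lemma qproj_local_homeo : is_local_homeo qproj.
Proof.
apply: (local_homeo_of_sections (S := local_section (qs_open X))) => [|s hs].
  exact: qs_cover.
exists (u^* (supp s)); split=> [x xs|w w' ws le_w].
  exists (u^* (supp x)); first exact: inv_image_mono (support_mono suppP xs).
  rewrite meetC -[qproj^* _ ⊓ s]qact_gu (gu_baseK etG); first exact: hs.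
  exact: supp_base.
have {}ws : direct_image u w ⊑ supp s.
  by rewrite -(gu_baseK etG (supp_base s)); exact: gu_direct_mono.
rewrite -(gu_directK etG w) -(gu_directK etG w'); apply: inv_image_mono.
rewrite -(meet_idPl ws) -(qmul_base invQ (gu_direct_base etG w) (supp_base s)).
rewrite -(support_act suppP _ (gu_direct_base etG w)).
apply: (@sle_trans _ _ (supp (qproj_inv w'))).
  by apply: (support_mono suppP); rewrite qact_gu meetC.
exact: (support_act_le suppP _ (gu_direct_base etG w')).
Qed.

Definition qsheaf_gsheaf : gsheaf G := GSheaf (gs_glocale := qsheaf_glocale) qproj_local_homeo.

End ModuleToSheaf.

(** * Equivariant maps and module homomorphisms *)

Section EquivariantMaps.
Variables (G : groupoid) (etG : etale G).
Local Notation u := (gu G).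
Local Notation Q := (groupoid_quantale etG).
Local Notation invQ := (groupoid_quantale_inverse etG).

Lemma act_open_monor (X : glocale G) (a : G1 G) (x x' : X) :
  x ⊑ x' -> act_open a x ⊑ act_open a x'.
Proof. by move=> xx'; apply: (act_open_mono etG) => //; exact: sle_refl. Qed.

Lemma act_open_baseE (X : glocale G) (b : G1 G) (x : X) : b ⊑ gq_one G ->
  act_open b x = (gl_proj X)^* (u^* b) ⊓ x.
Proof. by move=> be; rewrite -{1}(gu_baseK etG be) (act_open_base etG). Qed.

Lemma act_open_invK (X : glocale G) (s : G1 G) (x : X) : partial_unit (Q := Q) s ->
  act_open (gq_inv s) (act_open s x) ⊑ x.
Proof. exact: (@partial_unit_invK Q (glocale_qlocale etG X)). Qed.

Lemma act_open_Kinv (X : glocale G) (s : G1 G) (x : X) : partial_unit (Q := Q) s ->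
  act_open s (act_open (gq_inv s) x) ⊑ x.
Proof. exact: (@partial_unit_Kinv Q (glocale_qlocale etG X)). Qed.

Section Equivariant.
Variables (X Y : glocale G) (f : equivariant X Y).

(** Applying [f] to an element [g x] of [a · f^* y] gives [g (f x)], an element of
    [a · y]. *)
Let equivariant_act_lax a (y : Y) : act_open a (f^* y) ⊑ f^* (act_open a y).
Proof.
apply/(act_open_le etG).
have -> : (gl_act X)^* (f^* (act_open a y))
    = (gl_times (eqv_proj f))^* ((gl_act Y)^* (act_open a y)).
  exact: (congr1 (fun t => t^* (act_open a y)) (eqv_act f)).
apply/pb_le; apply: (pb_pair_ge (gl_times_compat (eqv_proj f))
  (I := (gl_act Y)^* (act_open a y))).
by apply/(act_open_le etG); exact: sle_refl.
Qed.

(** On a partial unit,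
    [f^* (s y) = s s^* f^* (s y) ⊑ s f^* (s^* s y) ⊑ s f^* y]; the equality uses that
    [s s^*] acts by a meet with an open pulled back from [G0]. *)
Lemma equivariant_act a (y : Y) : f^* (act_open a y) = act_open a (f^* y).
Proof.
apply: sle_anti; last exact: equivariant_act_lax.
apply: (@join_dense_le (G1 G) X _ (fun a => f^* (act_open a y))
  (fun a => act_open a (f^* y)) (partial_unit_dense invQ)).
- apply: (@preserves_sup_comp (G1 G) Y X); first exact: inv_image_sup.
  exact: (@act_open_supl G etG Y).
- by move=> a1 a2 le12; apply: (act_open_mono etG) => //; exact: sle_refl.
move=> s hs; have [s1 s2] := hs.
have sE : gq_mul (gq_mul s (gq_inv s)) s = s := partial_unitK invQ hs.
rewrite -{1}sE (act_openA etG) (act_open_baseE _ s2) inv_image_meet.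
have -> : f^* ((gl_proj Y)^* (u^* (gq_mul s (gq_inv s))))
    = (gl_proj X)^* (u^* (gq_mul s (gq_inv s))).
  exact: (congr1 (fun t => t^* (u^* (gq_mul s (gq_inv s)))) (eqv_proj f)).
rewrite -(act_open_baseE _ s2) (act_openA etG); apply: act_open_monor.
apply: (sle_trans (equivariant_act_lax _ _)); apply: inv_image_mono.
exact: act_open_invK.
Qed.

End Equivariant.

Section ModuleHom.
Variables (X Y : glocale G) (f : cmap X Y).
Hypothesis fact : forall a (y : Y), f^* (act_open a y) = act_open a (f^* y).

Lemma module_hom_proj : gl_proj Y ∘ f = gl_proj X.
Proof.
apply: cmap_eq => v; rewrite -[LHS]/(f^* ((gl_proj Y)^* v)) -[(gl_proj Y)^* v]meetT.
by rewrite -(act_open_base etG) fact (act_open_base etG) inv_image_top meetT.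
Qed.

(** If [s x ⊑ f^* y], then [s^* s x ⊑ f^* (s^* y)], so [(s, x)] may be enlarged to
    [(s, f^* (s^* y))], which comes from the pair [(s, s^* y)] over [y]. *)
Lemma module_hom_act : f ∘ gl_act X = gl_act Y ∘ gl_times module_hom_proj.
Proof.
apply: cmap_eq => y; apply: sle_anti; last first.
  apply: pb_pair_le => a z /(act_open_le etG) az_y; apply/pb_le/(act_open_le etG).
  by rewrite -fact; exact: inv_image_mono.
apply: (@pullback_le_partial_unit G etG X (gl_proj X)
  ((f ∘ gl_act X)^* y) ((gl_act Y ∘ gl_times module_hom_proj)^* y)).
move=> s x hs /(act_open_le etG) sx_y.
have [s1 s2] := hs.
apply: (opn_partial_unit (etG := etG) (y := f^* (act_open (gq_inv s) y)) hs).
  by rewrite -(act_open_baseE _ s1) (act_openA etG) fact; exact: act_open_monor.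
apply/pb_le; apply: (pb_pair_ge (gl_times_compat module_hom_proj) (I := (gl_act Y)^* y)).
apply/(act_open_le etG); exact: act_open_Kinv.
Qed.

Definition module_hom_equivariant : equivariant X Y := Equivariant module_hom_act.

End ModuleHom.

(** * The isomorphism of categories *)

Definition equivariant_qlh_hom (X Y : gsheaf G) (f : equivariant X Y) :
    qlh_hom (gsheaf_qsheaf etG X) (gsheaf_qsheaf etG Y) :=
  @QLHHom Q (gsheaf_qsheaf etG X) (gsheaf_qsheaf etG Y) f (equivariant_act f).

Definition sheaf_functor : functor (BG G) (QLH Q).
Proof.
apply: (@Functor (BG G) (QLH Q) (gsheaf_qsheaf etG) equivariant_qlh_hom).
- by move=> X; apply: qlh_hom_eq.
- by move=> X Y Z g f; apply: qlh_hom_eq.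
Defined.

(** Proofs being irrelevant, a G-sheaf on a given locale is determined by its
    projection and by the pairs belonging to the inverse images of its action; the
    pairs have the same type for both projections, which avoids a transport. *)
Lemma gsheaf_eq (X : locale) (p p' : cmap X (G0 G)) (a : cmap (pullback (gr G) p) X)
    (a' : cmap (pullback (gr G) p') X) pa aA a1 lh pa' aA' a1' lh' :
  (forall v, p^* v = p'^* v) ->
  (forall t b x, opn (a^* t) b x <-> opn (a'^* t) b x) ->
  @GSheaf G (@GLocale G X p a pa aA a1) lh = @GSheaf G (@GLocale G X p' a' pa' aA' a1') lh'.
Proof.
move=> /cmap_eq ep; subst p' => ea.
have {}ea : a = a'.
  by apply: cmap_eq => t; apply: sle_anti => b x /ea.
subst a'; rewrite (Prop_irrelevance pa' pa) in aA' lh' *.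
rewrite (Prop_irrelevance aA' aA) (Prop_irrelevance a1' a1) in lh' *.
by rewrite (Prop_irrelevance lh' lh).
Qed.

Lemma qsheaf_eq (X : locale) (M M' : qmodule Q X) b o c b' o' c' :
  (forall a x, M a x = M' a x) ->
  @QSheaf Q (@QLocale Q X M b) o c = @QSheaf Q (@QLocale Q X M' b') o' c'.
Proof.
move=> h; have e : M = M'.
  case: M M' h {b o c b' o' c'} => [f f1 f2 f3 f4] [g g1 g2 g3 g4] /= h.
  have e : f = g by apply: funext => a; apply: funext => x.
  by subst g; congr QModule; exact: Prop_irrelevance.
subst M'; rewrite (Prop_irrelevance b' b) in o' c' *.
rewrite (Prop_irrelevance o' o) in c' *.
by rewrite (Prop_irrelevance c' c).
Qed.

Lemma gsheaf_qsheafK (X : gsheaf G) : qsheaf_gsheaf (gsheaf_qsheaf etG X) = X.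
Proof.
case: X => [[X p a pa aA a1] lh]; apply: gsheaf_eq => [v|t b x].
  by rewrite /= /qproj_inv /= (act_open_base etG) meetT.
exact: (@act_open_le G etG (GLocale aA a1)).
Qed.

Lemma qsheaf_gsheafK (X : qsheaf Q) : gsheaf_qsheaf etG (qsheaf_gsheaf X) = X.
Proof.
case: X => [[X M b] o c]; apply: qsheaf_eq => a x; apply: eq_sle => t.
exact: (@act_open_le G etG (qsheaf_gsheaf (QSheaf c))).
Qed.

Lemma BG_isomorphic_QLH : isomorphic_categories (BG G) (QLH Q).
Proof.
apply: (@isomorphic_of_bijective _ _ sheaf_functor (@qsheaf_gsheaf G etG)
  gsheaf_qsheafK qsheaf_gsheafK
  (fun X Y (f : qlh_hom (gsheaf_qsheaf etG X) (gsheaf_qsheaf etG Y)) =>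
     @module_hom_equivariant X Y f (@qlh_act _ _ _ f))) => X Y f.
  exact: equivariant_eq.
exact: qlh_hom_eq.
Qed.

End EquivariantMaps.

Theorem theorem3p33 (G : groupoid) (etG : etale G) :
  isomorphic_categories (BG G) (QLH (groupoid_quantale etG)) /\
  isomorphic_categories (QLH (groupoid_quantale etG)) (QSh (groupoid_quantale etG)).
Proof.
split; first exact: BG_isomorphic_QLH.
exact: QLH_isomorphic_QSh (groupoid_quantale_inverse etG).
Qed.
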